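(* Let $n\ge2$, let $\Lambda=\mathrm{diag}(\lambda_1<\cdots<\lambda_n)$ be an a.p. free matrix, and let $\sigma:\mathcal{T}_\Lambda\to\mathbb{R}$ be a simple shift strategy for which diagonal matrices do not belong to $\mathcal{S}_\sigma$. Then there exist $\epsilon>0$, $C>0$ and $K>0$ such that: (a) the deflation neighborhood $\mathcal{D}_{\Lambda,\epsilon}$ is invariant under $F_\sigma$; (b) for any $T\in\mathcal{D}_{\Lambda,\epsilon}$, the sequence $(F_\sigma^k(T))$ converges to a diagonal matrix, and the set of positive integers $k$ for which $|b(F_\sigma^{k+1}(T))|>C|b(F_\sigma^k(T))|^3$ has at most $K$ elements.
   Context: A matrix with simple real spectrum is a.p. free if no three of its eigenvalues are in arithmetic progression. $\mathcal{T}_\Lambda$ is the set of real symmetric tridiagonal $n\times n$ matrices with spectrum $\{\lambda_1,\dots,\lambda_n\}$ (a connected compact smooth manifold); $b(T)=(T)_{n,n-1}$; $\mathcal{D}_{\Lambda,\epsilon}=\{T\in\mathcal{T}_\Lambda: |b(T)|\le\epsilon\}$. $\mathcal{E}$ is the group of diagonal matrices with diagonal entries $\pm1$. Steps: an $n\times n$ real matrix is almost invertible if its first $n-1$ columns are linearly independent. Every almost invertible $M$ has a unique factorization $M=Q_\star R_\star$ with $Q_\star\in SO(n)$ and $R_\star$ upper triangular with $(R_\star)_{i,i}>0$ for $i=1,\dots,n-1$. If $T-sI$ is almost invertible and $T-sI=Q_\star R_\star$, put $F_s(T)=Q_\star^{*}TQ_\star$. For $\sigma:\mathcal{T}_\Lambda\to\mathbb{R}$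 put $F_\sigma(T)=F_{\sigma(T)}(T)$, defined whenever $T-\sigma(T)I$ is almost invertible. Invariance of a set under $F_\sigma$ means that $F_\sigma$ is defined on it and maps it into itself. A simple shift strategy is a function $\sigma:\mathcal{T}_\Lambda\to\mathbb{R}$ with $\sigma(ETE)=\sigma(T)$ for all $T$ and all $E\in\mathcal{E}$, for which there exists $C_\sigma>0$ such that for every $T\in\mathcal{T}_\Lambda$ there is an index $i$ with $|\sigma(T)-\lambda_i|\le C_\sigma|b(T)|$ and $|(T)_{n,n}-\lambda_i|\le\sqrt2\,|b(T)|$. No continuity of $\sigma$ is assumed. The singular support $\mathcal{S}_\sigma\subset\mathcal{T}_\Lambda$ is the smallest closed set on whose complement $\sigma$ is smooth. *)

(* Defs.v *)
From mathcomp Require Import all_boot all_order all_algebra.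
From mathcomp Require Import all_classical all_reals all_analysis.

Set Implicit Arguments.
Unset Strict Implicit.
Unset Printing Implicit Defensive.

Import Order.TTheory GRing.Theory Num.Theory.
Import numFieldNormedType.Exports.

Local Open Scope classical_set_scope.
Local Open Scope ring_scope.

Section Smoothness.
Context {R : realType} {V : normedModType R}.
Implicit Types (U W X S : set V) (f g : V -> R).

(* Class C^k on an open set U, by means of directional derivatives; the values
   of f outside U play no role. *)
Fixpoint Ck (k : nat) U f : Prop :=
  match k with
  | 0 => forall x, U x -> {for x, continuous f}
  | k'.+1 => (forall x, U x -> differentiable f x) /\
             (forall v : V, Ck k' U (fun x => 'D_v f x))
  end.

(* f, seen as a function on the subset X of V, is smooth at every point of W:
   near each such point it is the restriction to X of an ambient C^oo function.
   For an embedded submanifold X this is smoothness on the manifold, and the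
   values of f outside X play no role. *)
Definition smooth_on X W f : Prop :=
  forall x, W x -> exists U g,
    [/\ open U, U x, forall k, Ck k U g & forall y, (U `&` X) y -> g y = f y].

(* The closed subsets of the subspace X are the traces on X of the closed
   subsets of V. *)
Definition sing_supp X f : set V :=
  X `&` \bigcap_(S in [set S | closed S /\ smooth_on X (X `\` S) f]) S.

Lemma sing_supp_smooth X f : smooth_on X (X `\` sing_supp X f) f.
Proof.
move=> x [Xx nSx].
have [S nS] : exists S, ~ ((closed S /\ smooth_on X (X `\` S) f) -> S x).
  by apply/existsNP => H; apply: nSx; split=> // S [cS sS]; apply: H.
by move/not_implyP: nS => [[_ sS] nSx']; apply: sS.
Qed.

Lemma sing_supp_closed X f : exists2 S, closed S & sing_supp X f = X `&` S.
Proof.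
exists (\bigcap_(S in [set S | closed S /\ smooth_on X (X `\` S) f]) S) => //.
by apply: closed_bigI => S [].
Qed.

Lemma sing_supp_least X S f :
  closed S -> smooth_on X (X `\` S) f -> sing_supp X f `<=` X `&` S.
Proof. by move=> cS sS x [Xx H]; split=> //; apply: H. Qed.

End Smoothness.

Section Matrices.
Context {R : realType}.

Definition tridiagonal n (T : 'M[R]_n) : Prop :=
  forall i j : 'I_n, (i.+1 < j)%N || (j.+1 < i)%N -> T i j = 0.

Definition spectrum n (M : 'M[R]_n) : set R := [set x | eigenvalue M x].

Definition ap_free n (M : 'M[R]_n) : Prop :=
  forall x y z, spectrum M x -> spectrum M y -> spectrum M z ->
    x < y -> y < z -> y - x != z - y.

Definition sign_diag n (E : 'M[R]_n) : Prop :=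
  is_diag_mx E /\ forall i, E i i = 1 \/ E i i = -1.

Definition SO n (Q : 'M[R]_n) : Prop := Q^T *m Q = 1%:M /\ \det Q = 1.

Definition almost_invertible n (M : 'M[R]_n.+1) : bool :=
  row_free (col' ord_max M)^T.

(* is_trig_mx means lower triangular. *)
Definition qr_star n (M Q U : 'M[R]_n.+1) : Prop :=
  [/\ M = Q *m U, SO Q, is_trig_mx U^T &
      forall i : 'I_n.+1, i != ord_max -> 0 < U i i].

(* The factorization is unique when M is almost invertible; otherwise Qstar M
   is not meaningful. *)
Definition Qstar n (M : 'M[R]_n.+1) : 'M[R]_n.+1 :=
  xget 1%:M [set Q | exists U, qr_star M Q U].

Definition Fstep n (s : R) (T : 'M[R]_n.+1) : 'M[R]_n.+1 :=
  let Q := Qstar (T - s%:M) in Q^T *m T *m Q.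

Definition Fshift n (sigma : 'M[R]_n.+1 -> R) (T : 'M[R]_n.+1) : 'M[R]_n.+1 :=
  Fstep (sigma T) T.

Definition Fshift_defined n (sigma : 'M[R]_n.+1 -> R) (T : 'M[R]_n.+1) : bool :=
  almost_invertible (T - (sigma T)%:M).

Definition invariant_under n (sigma : 'M[R]_n.+1 -> R) (D : set 'M[R]_n.+1) :
    Prop :=
  forall T, D T -> Fshift_defined sigma T /\ D (Fshift sigma T).

Definition TLambda n (lam : 'I_n -> R) : set 'M[R]_n :=
  [set T | [/\ T^T = T, tridiagonal T & spectrum T = range lam]].

(* Indices start at 0: for matrices of size n + 2 this is the entry in the last
   row and next-to-last column. *)
Definition b n (T : 'M[R]_n.+2) : R := T ord_max (inord n).

Definition Deflation n (lam : 'I_n.+2 -> R) (eps : R) : set 'M[R]_n.+2 :=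
  [set T | TLambda lam T /\ `|b T| <= eps].

(* A function on TLambda is represented by a function on all matrices, of which
   only the values on TLambda are ever used. *)
Definition simple_shift n (lam : 'I_n.+2 -> R) (sigma : 'M[R]_n.+2 -> R) :
    Prop :=
  (forall T E, TLambda lam T -> sign_diag E ->
     sigma (E *m T *m E) = sigma T) /\
  (exists2 Csigma : R, 0 < Csigma & forall T, TLambda lam T ->
     exists i, `|sigma T - lam i| <= Csigma * `|b T| /\
               `|T ord_max ord_max - lam i| <= Num.sqrt 2 * `|b T|).

End Matrices.

(* Main.v *)
Require Import Defs.
From mathcomp Require Import all_boot all_order all_algebra.
From mathcomp Require Import all_classical all_reals all_analysis.
From mathcomp Require Import ring lra.
Import Order.TTheory GRing.Theory Num.Theory.
Import numFieldNormedType.Exports.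
Local Open Scope classical_set_scope.
Local Open Scope card_scope.
Local Open Scope ring_scope.

(** Write the eigenvectors of T as the rows of an orthogonal matrix V, so that
    T = V^T diag(lam) V.  A step with shift s replaces V by V Q, and the last
    column w of V becomes a vector w' with (lam_j - s) w'_j = r w_j for some
    number r: the step is inverse iteration on the last basis vector.

    Contraction.  If c is the eigenvalue close to the corner entry T_nn, then
    b(T)^2 + (T_nn - c)^2 = sum_j (lam_j - c)^2 w_j^2, and the recursion for w
    multiplies this quantity by O((s - c)^2) ([shift_step]).  Since the shift
    strategy gives |s - c| = O(|b|), the entry b is at least halved by every
    step, c never changes along an orbit, and the neighborhood is invariant
    ([locked_step]).  The same estimate gives |b(T')| = O(|b(T)|^3) whenever
    |s - c| = O(b^2).

    Quadratic accuracy of the shift near a diagonal matrix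
    ([shift_quadratic_near]).  Let M be T with the entries b erased, and let E
    change the last sign: T and ETE are M + bW and M - bW for a fixed W, and
    sigma takes the same value on both.  A second difference of a smooth
    extension of sigma shows that its value at M is sigma(T) + O(b^2).  The matrix
    M need not be isospectral to T, but it is O(b^2)-close to some T0 which is:
    the QR step for the projection 1 - v v^T, with v the eigenvector of c, in place of
    T - s deflates T exactly, and it moves T little because the Cholesky factor
    of 1 - v v^T is close to the identity ([exact_deflation]).  Finally
    sigma(T0) = c because b(T0) = 0.

    Most steps take place near diagonal matrices.  If T - s = Q U, then
    (T - s)^2 = U^T U and (T' - s)^2 = U U^T, so the sum of l ((T - s)^2)_ll
    over l decreases by at least the squared mass of U above the diagonal.  The
    shifts approach c with summable errors, whence a bound on the sum of
    these masses over an orbit, uniform over the neighborhood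
    ([orbit_upper_mass]).  When the mass is small, (T - s)^2 is nearly diagonal;
    its eigenvalues (lam_j - s)^2 are separated because no three eigenvalues are in
    arithmetic progression, so T is itself close to a diagonal matrix
    ([small_upper_mass_near_diag]).  All but a bounded number of steps are
    therefore cubic.  The masses tend to 0, which pins the orbit to a
    single diagonal matrix in the limit ([orbit_converges]). *)

(** * Existence of the QR factorization *)

Section Orthogonal.
Set Implicit Arguments.
Unset Strict Implicit.
Context {R : realType}.

(** Independence of all columns but the last, in the form that suits eigenvectors:
    a kernel vector with last coordinate 0 vanishes. *)
Definition kernel_avoids n (M : 'M[R]_n.+1) :=
  forall u : 'cV[R]_n.+1, u ord_max 0 = 0 -> M *m u = 0 -> u = 0.

Lemma almost_invertibleP n (M : 'M[R]_n.+1) :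
  almost_invertible M <-> kernel_avoids M.
Proof.
rewrite /almost_invertible; split.
  move=> fM u u0 Mu0.
  have : (row' ord_max u)^T *m (col' ord_max M)^T = 0.
    rewrite -trmx_mul; apply/eqP; rewrite trmx_eq0; apply/eqP/colP => i.
    move/colP: Mu0 => /(_ i); rewrite !mxE => Mi; rewrite -[RHS]Mi.
    rewrite [RHS](bigD1_ord ord_max) //= u0 mulr0 add0r.
    by apply: eq_bigr => j _; rewrite !mxE.
  move/eqP; rewrite (mulmx_free_eq0 _ fM) trmx_eq0 => /eqP/colP u'0.
  apply/colP => i; rewrite [RHS]mxE; case: (unliftP ord_max i) => [j|] -> //.
  by have := u'0 j; rewrite !mxE.
move=> kM; rewrite -kermx_eq0; apply/rowV0P => v /sub_kermxP vM0.
pose u : 'cV[R]_n.+1 := \col_i (if unlift ord_max i is Some j then v 0 j else 0).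
have u0 : u = 0.
  apply: kM; first by rewrite mxE unlift_none.
  apply/colP => i; move/rowP: vM0 => /(_ i); rewrite !mxE => vMi.
  rewrite -[RHS]vMi (bigD1_ord ord_max) //= mxE unlift_none mulr0 add0r.
  by apply: eq_bigr => j _; rewrite !mxE liftK mulrC.
apply/rowP => j; move/colP: u0 => /(_ (lift ord_max j)).
by rewrite !mxE liftK.
Qed.

Lemma gram_eq0 n (u : 'cV[R]_n) : (u^T *m u) 0 0 = 0 -> u = 0.
Proof.
rewrite mxE => u0; apply/colP => i; rewrite mxE.
have /psumr_eq0P : forall j, true -> 0 <= u^T 0 j * u j 0.
  by move=> j _; rewrite mxE sqr_ge0.
move=> /(_ u0) /(_ i isT) /eqP; rewrite mxE mulf_eq0 orbb => /eqP //.
Qed.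

Lemma orthogonal_det n (Q : 'M[R]_n) : Q^T *m Q = 1%:M -> \det Q = 1 \/ \det Q = -1.
Proof.
move=> /(congr1 determinant); rewrite det_mulmx det_tr det1 => /eqP.
by rewrite -expr2 sqrf_eq1 => /orP[/eqP|/eqP]; [left|right].
Qed.

(** Changing the sign of the last column repairs the determinant; this spares the
    first column because there are at least two. *)
Lemma orthogonal_flip n (Q : 'M[R]_n.+2) : Q^T *m Q = 1%:M ->
  exists2 H, SO H & col 0 H = col 0 Q.
Proof.
move=> QQ; case: (orthogonal_det QQ) => dQ; first by exists Q.
pose d : 'rV[R]_n.+2 := \row_i (-1) ^+ (i == ord_max).
have dd : diag_mx d *m diag_mx d = 1%:M.
  apply/matrixP => i j; rewrite mul_diag_mx !mxE; case: (eqVneq i j) => _.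
  - by rewrite mulr1n -expr2 sqrr_sign.
  - by rewrite mulr0n mulr0.
exists (Q *m diag_mx d); first split.
- rewrite trmx_mul tr_diag_mx mulmxA -(mulmxA _ _ Q) QQ mulmx1 //.
- rewrite det_mulmx dQ det_diag (bigD1 ord_max) //= mxE eqxx big1 ?expr1 ?mulr1 ?mulrNN ?mulr1 //.
  by move=> i /negbTE ni; rewrite mxE ni.
- apply/colP => i; rewrite !mxE (bigD1 0) //= big1 ?addr0.
    by rewrite !mxE eqxx mulr1n mulr1.
  by move=> j /negbTE nj; rewrite !mxE nj mulr0n mulr0.
Qed.

(** The reflection exchanging [a] and the first basis vector, up to the sign of its
    last column. *)
Lemma householder n (a : 'cV[R]_n.+2) : a^T *m a = 1%:M ->
  exists2 H, SO H & col 0 H = a.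
Proof.
move=> aa; suff [Q QQ <-] : exists2 Q : 'M[R]_n.+2, Q^T *m Q = 1%:M & col 0 Q = a.
  by have [H HS <-] := orthogonal_flip QQ; exists H.
pose e : 'cV[R]_n.+2 := delta_mx 0 0.
have [->|ane] := eqVneq a e.
  exists 1%:M; first by rewrite trmx1 mulmx1.
  by apply/colP => i; rewrite !mxE eqxx andbT.
have ee : e^T *m e = 1%:M.
  by rewrite trmx_delta mul_delta_mx; apply/matrixP => i j; rewrite !ord1 !mxE.
pose w := a - e; pose c := (w^T *m w) 0 0.
have wwE : w^T *m w = c%:M by rewrite [LHS]mx11_scalar.
have c0 : c != 0.
  by apply: contra ane => /eqP /gram_eq0 /eqP; rewrite subr_eq0.
have [k kc] : exists k, k * c = 2 by exists (2 / c); rewrite mulfVK.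
exists (1%:M - k *: (w *m w^T)).
  rewrite [X in X *m _](_ : _ = 1%:M - k *: (w *m w^T)); last first.
    apply/matrixP => i j; rewrite !mxE eq_sym; congr (_ - _ * _).
    by apply: eq_bigr => l _; rewrite !mxE mulrC.
  rewrite mulmxBl mul1mx mulmxBr mulmx1 -scalemxAl -scalemxAr.
  rewrite mulmxA -(mulmxA w) wwE mul_mx_scalar -scalemxAl !scalerA kc.
  move: (w *m w^T) => X; apply/matrixP => i j; rewrite !mxE; ring.
have ae : a^T *m e = (e^T *m a).
  by apply/matrixP => i j; rewrite !ord1 !mxE; apply: eq_bigr => l _; rewrite !mxE mulrC.
have wT : w^T = a^T - e^T by apply/matrixP => i j; rewrite !mxE.
have wwe : w^T *m e = (- c / 2)%:M.
  have : w^T *m w = - 2 *: (w^T *m e).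
    rewrite {2}/w wT !mulmxBr !mulmxBl aa ee ae.
    by apply/matrixP => i j; rewrite !ord1 !mxE; ring.
  rewrite wwE => cE; apply: (@scalerI _ _ (-2 : R)); first by rewrite oppr_eq0.
  by rewrite -cE scale_scalar_mx; congr (_%:M); field.
have -> : col 0 (1%:M - k *: (w *m w^T)) = (1%:M - k *: (w *m w^T)) *m e.
  by rewrite -colE.
rewrite mulmxBl mul1mx -scalemxAl -mulmxA wwe mul_mx_scalar scalerA.
have -> : k * (- c / 2) = -1 by rewrite mulNr mulrN mulrA kc divff.
by rewrite scaleN1r opprK addrC subrK.
Qed.

(** Induction on the size: an element of SO whose first column is the normalized
    first column of [M] clears that column, and the remaining block
    inherits [kernel_avoids], since a vector of its kernel extends to one of the
    kernel of [M] by solving the first row. *)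
Lemma qr_star_exists n (M : 'M[R]_n.+1) : kernel_avoids M ->
  exists Q U, qr_star M Q U.
Proof.
elim: n M => [|n IH] M kM.
  exists 1%:M, M; split; rewrite ?mul1mx //; first by split; rewrite ?trmx1 ?mulmx1 ?det1.
    by apply/is_trig_mxP => i j; rewrite !ord1.
  by move=> i; rewrite !ord1.
pose a := col 0 M; pose nn := (a^T *m a) 0 0.
have nn0 : 0 < nn.
  rewrite lt_neqAle eq_sym; apply/andP; split; last first.
    by rewrite /nn mxE sumr_ge0 // => i _; rewrite mxE sqr_ge0.
  apply/negP => /eqP /gram_eq0 a0.
  have e0 : delta_mx 0 0 = 0 :> 'cV[R]_n.+2.
    by apply: kM; [rewrite mxE|rewrite -colE].
  by move/colP: e0 => /(_ 0); rewrite !mxE /= => /eqP; rewrite oner_eq0.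
pose r := Num.sqrt nn.
have r0 : 0 < r by rewrite sqrtr_gt0.
have rr : r * r = nn by rewrite -expr2 sqr_sqrtr // ltW.
have [H [HH dH] colH] : exists2 H, SO H & col 0 H = r^-1 *: a.
  apply: householder; rewrite [X in X *m _]linearZ /= -scalemxAl -scalemxAr scalerA.
  rewrite [a^T *m a]mx11_scalar -/nn -rr scale_scalar_mx; congr (_%:M).
  by field; rewrite gt_eqF.
have HH' : H *m H^T = 1%:M by apply: mulmx1C.
have aE : a = r *: col 0 H by rewrite colH scalerA divff ?scale1r // gt_eqF.
have [B Beq] : exists B : 'M[R]_(1 + n.+1), B = H^T *m M by eexists.
have B0 : forall i, B i 0 = r * (i == 0)%:R.
  move=> i; rewrite Beq; have -> : (H^T *m M) i 0 = (H^T *m a) i 0.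
    by rewrite !mxE; apply: eq_bigr => j _; rewrite !mxE.
  by rewrite aE -scalemxAr colE mulmxA HH mul1mx !mxE /= andbT.
pose M2 : 'M[R]_n.+1 := drsubmx B.
have BE : B = block_mx r%:M (ursubmx B) 0 M2.
  rewrite -[LHS]submxK; congr block_mx.
    rewrite [LHS]mx11_scalar; congr (_%:M); rewrite !mxE.
    by rewrite lshift0 B0 eqxx mulr1.
  by apply/matrixP => i j; rewrite !mxE ord1 lshift0 B0 eq_sym mulr0.
have [Q2 [U2 [M2E [QQ2 dQ2] tU2 pU2]]] : exists Q U, qr_star M2 Q U.
  apply: IH => u um Mu.
  pose y : 'cV[R]_1 := - r^-1 *: (ursubmx B *m u).
  have : col_mx y u = 0.
    apply: kM.
      rewrite (_ : ord_max = rshift 1 (ord_max : 'I_n.+1)); last exact: val_inj.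
      by rewrite [LHS](col_mxEd y u).
    have : B *m col_mx y u = 0.
      rewrite BE mul_block_col Mu mul0mx addr0 mul_scalar_mx scalerA.
      by rewrite mulrN divff ?gt_eqF // scaleN1r addNr col_mx0.
    rewrite Beq => /(congr1 (mulmx H)).
    by rewrite !mulmxA HH' mul1mx mulmx0.
  by rewrite -[0]col_mx0 => /eq_col_mx[].
pose Q1 : 'M[R]_(1 + n.+1) := block_mx 1%:M 0 0 Q2.
pose U1 : 'M[R]_(1 + n.+1) := block_mx r%:M (ursubmx B) 0 U2.
have Q1E : Q1^T *m Q1 = 1%:M.
  rewrite /Q1 tr_block_mx mulmx_block !trmx0 trmx1 !mulmx0 !mul0mx.
  by rewrite !addr0 add0r mulmx1 QQ2 -scalar_mx_block.
have Q1U1 : Q1 *m U1 = B.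
  by rewrite mulmx_block !mul0mx !mul1mx !mulmx0 !addr0 !add0r -M2E -BE.
exists (H *m Q1), U1; split.
- by rewrite -mulmxA Q1U1 Beq mulmxA HH' mul1mx.
- split; first by rewrite trmx_mul mulmxA -(mulmxA Q1^T) HH mulmx1.
  by rewrite det_mulmx dH mul1r (det_ublock (1%:M : 'M[R]_1) 0 Q2) det1 mul1r.
- rewrite (tr_block_mx (m1 := 1) (n1 := 1)) trmx0; 
  by rewrite (is_trig_block_mx (m1 := 1) (n1 := 1)) // eqxx tU2 mx11_is_trig.
- move=> i; case: (unliftP 0 i) => [j|] -> im.
    rewrite (_ : lift 0 j = rshift 1 j); last exact: val_inj.
    rewrite (block_mxEdr (m1 := 1) (n1 := 1)); apply: pU2.
    by apply: contra im => /eqP ->; apply/eqP; exact: val_inj.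
  rewrite -(lshift0 n.+1 0).
  by rewrite (block_mxEul (m1 := 1) (n1 := 1)) mxE eqxx mulr1n.
Qed.

Lemma Qstar_qr_star n (M : 'M[R]_n.+1) : kernel_avoids M ->
  exists U, qr_star M (Qstar M) U.
Proof.
move=> /qr_star_exists [Q [U qrM]].
by apply: (xgetPex 1%:M (P := [set Q | exists U, qr_star M Q U])); exists Q, U.
Qed.

End Orthogonal.

(** * Spectral form of a matrix *)

Section Spectral.
Set Implicit Arguments.
Unset Strict Implicit.
Context {R : realType}.

(** With [V] orthogonal and T = spec_mx V lam, the matrix f(T) is spec_mx V (f o lam). *)
Definition spec_mx n (V : 'M[R]_n) (f : 'I_n -> R) : 'M[R]_n :=
  V^T *m diag_mx (\row_j f j) *m V.

Lemma mul_diagE n p (f : 'I_n -> R) (A : 'M[R]_(n, p)) j l :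
  (diag_mx (\row_i f i) *m A) j l = f j * A j l.
Proof. by rewrite mul_diag_mx !mxE. Qed.

Lemma spec_mxE n (V : 'M[R]_n) f l m : spec_mx V f l m = \sum_j f j * V j l * V j m.
Proof.
rewrite /spec_mx -mulmxA mul_diag_mx !mxE; apply: eq_bigr => j _.
by rewrite !mxE mulrCA mulrA.
Qed.

Lemma spec_mx_sym n (V : 'M[R]_n) f : (spec_mx V f)^T = spec_mx V f.
Proof. by rewrite /spec_mx !trmx_mul trmxK tr_diag_mx mulmxA. Qed.

Lemma spec_mx_mul n (V Q : 'M[R]_n) f : spec_mx (V *m Q) f = Q^T *m spec_mx V f *m Q.
Proof. by rewrite /spec_mx trmx_mul !mulmxA. Qed.

Lemma mul_spec_mx n (V : 'M[R]_n) f : V *m V^T = 1%:M ->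
  V *m spec_mx V f = diag_mx (\row_j f j) *m V.
Proof. by move=> VV; rewrite /spec_mx !mulmxA VV mul1mx. Qed.

Lemma spec_mxM n (V : 'M[R]_n) f g : V *m V^T = 1%:M ->
  spec_mx V f *m spec_mx V g = spec_mx V (fun j => f j * g j).
Proof.
move=> VV; rewrite /spec_mx !mulmxA -(mulmxA (V^T *m _) V V^T) VV mulmx1.
rewrite -(mulmxA V^T) mulmx_diag.
by congr (_ *m diag_mx _ *m _); apply/rowP => j; rewrite !mxE.
Qed.

Lemma spec_mx_sub_scalar n (V : 'M[R]_n) f s : V *m V^T = 1%:M ->
  spec_mx V f - s%:M = spec_mx V (fun j => f j - s).
Proof.
move=> /mulmx1C VV; have -> : s%:M = spec_mx V (fun => s).
  rewrite /spec_mx (_ : \row__ _ = const_mx s) ?diag_const_mx.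
    by rewrite -mulmxA mul_scalar_mx -scalemxAr VV scalemx1.
  by apply/rowP => j; rewrite !mxE.
apply/matrixP => l m; rewrite [LHS]mxE [X in _ + X]mxE !spec_mxE -sumrB.
by apply: eq_bigr => j _; ring.
Qed.

Lemma orth_rows n (V : 'M[R]_n) i j : V *m V^T = 1%:M ->
  \sum_l V i l * V j l = (i == j)%:R.
Proof.
by move=> /matrixP /(_ i j); rewrite !mxE => <-; apply: eq_bigr => l _; rewrite mxE.
Qed.

Lemma orth_cols n (V : 'M[R]_n) l m : V *m V^T = 1%:M ->
  \sum_j V j l * V j m = (l == m)%:R.
Proof.
by move=> /mulmx1C /matrixP /(_ l m); rewrite !mxE => <-; apply: eq_bigr => j _; rewrite mxE.
Qed.

Lemma orth_col_sqr n (V : 'M[R]_n) l : V *m V^T = 1%:M -> \sum_j V j l ^+ 2 = 1.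
Proof. by move=> /(orth_cols l l); rewrite eqxx. Qed.

Lemma orth_row_sqr n (V : 'M[R]_n) j : V *m V^T = 1%:M -> \sum_l V j l ^+ 2 = 1.
Proof. by move=> /(orth_rows j j); rewrite eqxx. Qed.

Lemma orth_sqr_le1 n (V : 'M[R]_n) j l : V *m V^T = 1%:M -> V j l ^+ 2 <= 1.
Proof.
move=> /(orth_col_sqr l) <-; rewrite (bigD1 j) //= lerDl.
by apply: sumr_ge0 => i _; apply: sqr_ge0.
Qed.

Lemma orth_le1 n (V : 'M[R]_n) j l : V *m V^T = 1%:M -> `|V j l| <= 1.
Proof. by move=> /(orth_sqr_le1 j l); rewrite -[X in X <= _]real_normK ?num_real // expr_le1. Qed.

Lemma spectrum_spec_mx n (V : 'M[R]_n) f : V *m V^T = 1%:M ->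
  spectrum (spec_mx V f) = range f.
Proof.
move=> VV; have VV' := mulmx1C VV; apply/seteqP; split => [a /eigenvalueP [v va v0]|_ [j _ <-]].
  have u0 : v *m V^T != 0.
    apply: contra v0 => /eqP /(congr1 (mulmx^~ V)).
    by rewrite -mulmxA VV' mulmx1 mul0mx => ->.
  have /rV0Pn[j uj] := u0; exists j => //.
  have : v *m spec_mx V f *m V^T = a *: (v *m V^T) by rewrite va scalemxAl.
  rewrite /spec_mx -!mulmxA VV mulmx1 mulmxA => /rowP /(_ j).
  by rewrite mul_mx_diag !mxE [RHS]mulrC => h; apply: (mulfI uj); rewrite !mxE.
apply/eigenvalueP; exists (row j V).
  rewrite -row_mul mul_spec_mx //; apply/rowP => l; rewrite mul_diag_mx !mxE //.
apply/eqP => /rowP v0; have := orth_row_sqr j VV; rewrite big1 => [/eqP|l _].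
  by rewrite eq_sym oner_eq0.
by have := v0 l; rewrite !mxE => ->; rewrite expr0n.
Qed.

(** Eigenvectors for distinct eigenvalues of a symmetric matrix are orthogonal, so
    a simple real spectrum yields an orthonormal eigenbasis without the general spectral
    theorem. *)
Lemma TLambdaP n (lam : 'I_n -> R) (T : 'M[R]_n) : injective lam ->
  TLambda lam T <-> tridiagonal T /\ exists2 V, V *m V^T = 1%:M & T = spec_mx V lam.
Proof.
move=> lamI; split=> [[symT triT spT]|[triT [V VV TE]]]; last first.
  by subst T; split; [exact: spec_mx_sym| |exact: spectrum_spec_mx].
split=> //.
have /fin_all_exists [x xP] : forall j, exists v : 'rV[R]_n, v *m T = lam j *: v /\ v *m v^T = 1%:M.
  move=> j; have /eigenvalueP [v vT v0] : eigenvalue T (lam j).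
    by have : spectrum T (lam j) by rewrite spT; exists j.
  pose c := (v *m v^T) 0 0.
  have c0 : 0 < c.
    rewrite lt_neqAle; apply/andP; split; last first.
      by rewrite /c mxE sumr_ge0 // => i _; rewrite mxE sqr_ge0.
    rewrite eq_sym; apply: contra v0 => /eqP c0; rewrite -trmx_eq0; apply/eqP.
    by apply: gram_eq0; rewrite trmxK.
  exists ((Num.sqrt c)^-1 *: v); split.
    by rewrite -scalemxAl vT !scalerA mulrC.
  rewrite -scalemxAl linearZ /= -scalemxAr scalerA [v *m v^T]mx11_scalar -/c.
  rewrite scale_scalar_mx -invfM -expr2 sqr_sqrtr ?(ltW c0) // mulVf //.
  by rewrite gt_eqF.
have xo i j : i != j -> x i *m (x j)^T = 0.
  move=> ij; have : lam i *: (x i *m (x j)^T) = lam j *: (x i *m (x j)^T).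
    rewrite scalemxAl -(xP i).1 scalemxAr -linearZ /= -(xP j).1 trmx_mul symT.
    by rewrite mulmxA.
  move/eqP; rewrite -subr_eq0 -scalerBl scaler_eq0 subr_eq0 => /orP[|/eqP //].
  by move=> /eqP /lamI /eqP; rewrite (negbTE ij).
pose V : 'M[R]_n := \matrix_(j, l) x j 0 l.
have VV : V *m V^T = 1%:M.
  apply/matrixP => i j; transitivity ((x i *m (x j)^T) 0 0).
    by rewrite !mxE; apply: eq_bigr => l _; rewrite !mxE.
  by have [->|ij] := eqVneq i j; rewrite ?(xP j).2 ?xo // !mxE ?eqxx // (negbTE ij).
exists V => //.
have : V *m T = diag_mx (\row_j lam j) *m V.
  apply/matrixP => j m; rewrite mul_diag_mx !mxE.
  have /rowP /(_ m) := (xP j).1; rewrite !mxE => <-.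
  by apply: eq_bigr => l _; rewrite mxE.
by move=> /(congr1 (mulmx V^T)); rewrite !mulmxA (mulmx1C VV) mul1mx.
Qed.

End Spectral.

(** * QR steps in spectral form *)

Section Step.
Set Implicit Arguments.
Unset Strict Implicit.
Context {R : realType} {n : nat}.
Implicit Types (V Q U M T : 'M[R]_n.+1) (f lam : 'I_n.+1 -> R).

Lemma qr_star_trig M Q U : qr_star M Q U -> forall l m : 'I_n.+1, (m < l)%N -> U l m = 0.
Proof. by move=> [_ _ /is_trig_mxP tU _] l m ml; have := tU _ _ ml; rewrite mxE. Qed.

(** The kernel of f(T) is contained in the line of the [i]-th eigenvector, whose
    last coordinate is not 0. *)
Lemma kernel_avoids_spec_mx V f i : V *m V^T = 1%:M ->
  (forall j, j != i -> f j != 0) -> V i ord_max != 0 -> kernel_avoids (spec_mx V f).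
Proof.
move=> VV f0 Vi u um /(congr1 (mulmx V)).
rewrite mulmxA mul_spec_mx // mulmx0 -mulmxA => /colP fVu.
have Vu j : j != i -> (V *m u) j 0 = 0.
  move=> ji; have /eqP := fVu j; rewrite mul_diagE [X in _ == X]mxE.
  by rewrite mulf_eq0 (negbTE (f0 _ ji)) /= => /eqP.
have uE : u = V^T *m (V *m u) by rewrite mulmxA (mulmx1C VV) mul1mx.
have uE' l : u l 0 = V i l * (V *m u) i 0.
  rewrite {1}uE mxE (bigD1 i) //= big1 ?addr0 ?mxE // => j /Vu ->.
  by rewrite mulr0.
have /eqP := uE' ord_max; rewrite um eq_sym mulf_eq0 (negbTE Vi) /= => /eqP z.
by apply/colP => l; rewrite uE' z mulr0 mxE.
Qed.

Lemma qr_star_gram M Q U : qr_star M Q U -> M^T = M -> U^T *m U = M *m M.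
Proof.
move=> [ME [QQ _] _ _] sM; rewrite -{1}sM ME trmx_mul mulmxA -(mulmxA U^T) QQ.
by rewrite mulmx1.
Qed.

Lemma qr_star_cogram M Q U : qr_star M Q U -> M^T = M ->
  U *m U^T = Q^T *m (M *m M) *m Q.
Proof.
move=> [ME [QQ _] _ _] sM; rewrite -{2}sM ME trmx_mul !mulmxA QQ mul1mx.
by rewrite -mulmxA QQ mulmx1.
Qed.

(** Since f(T) is symmetric, f(T) Q = U^T, and the last column of U^T is a
    multiple of the last basis vector.  Read in the eigenbasis, this is inverse
    iteration for f(T). *)
Lemma qr_star_last V f Q U : V *m V^T = 1%:M -> qr_star (spec_mx V f) Q U ->
  forall j, f j * (V *m Q) j ord_max = U ord_max ord_max * V j ord_max.
Proof.
move=> VV qr j; have [ME [QQ _] _ _] := qr.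
have : diag_mx (\row_j f j) *m (V *m Q) = V *m U^T.
  rewrite mulmxA -mul_spec_mx // -mulmxA -{1}(spec_mx_sym V f) ME trmx_mul -mulmxA QQ.
  by rewrite mulmx1.
move=> /matrixP /(_ j ord_max); rewrite mul_diagE => h; rewrite [LHS]h.
rewrite mxE (bigD1 ord_max) //= big1 => [|l lm].
  by rewrite addr0 mxE mulrC.
rewrite mxE (qr_star_trig qr) ?mulr0 //.
by rewrite ltn_neqAle -ltnS ltn_ord andbT; apply: contra lm => /eqP h'; apply/eqP/val_inj.
Qed.

(** Because T and f(T) commute, (Q^T T Q) U = Q^T T f(T) = U T: the form of
    similarity that survives when [U] is singular, as for exact shifts and projections. *)
Lemma qr_star_intertwine V lam f Q U : V *m V^T = 1%:M -> qr_star (spec_mx V f) Q U ->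
  spec_mx (V *m Q) lam *m U = U *m spec_mx V lam.
Proof.
move=> VV [ME [QQ _] _ _]; rewrite spec_mx_mul -mulmxA -ME -mulmxA spec_mxM //.
under [X in spec_mx V X]eq_fun do rewrite mulrC.
by rewrite -spec_mxM // {1}ME !mulmxA QQ mul1mx.
Qed.

Lemma qr_star_orth V M Q U : V *m V^T = 1%:M -> qr_star M Q U ->
  V *m Q *m (V *m Q)^T = 1%:M.
Proof.
by move=> VV [_ [QQ _] _ _]; rewrite trmx_mul mulmxA -(mulmxA V) (mulmx1C QQ) mulmx1.
Qed.

(** [U T] is a Hessenberg matrix; comparing columns from left to right in T' U = U T,
    the positive pivots of [U] force T' to be one too.  The last
    pivot may be 0 but never enters, as the last column has no entry below the
    subdiagonal. *)
Lemma qr_star_tridiagonal V lam f Q U : V *m V^T = 1%:M ->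
  qr_star (spec_mx V f) Q U -> tridiagonal (spec_mx V lam) ->
  tridiagonal (spec_mx (V *m Q) lam).
Proof.
move=> VV qr tri; have [_ _ _ pU] := qr.
set T := spec_mx V lam; set T' := spec_mx _ _.
suff lower : forall k (i j : 'I_n.+1), (j < k)%N -> (j.+1 < i)%N -> T' i j = 0.
  move=> i j /orP[ij|ji]; last exact: (lower n.+1).
  by rewrite /T' -spec_mx_sym mxE; apply: (lower n.+1).
elim=> // k IH i j jk ji.
have jm : j != ord_max.
  apply/eqP => jE; move: ji; rewrite jE /= ltnNge -ltnS.
  by rewrite (ltn_trans (ltn_ord i)).
have : (T' *m U) i j = (U *m T) i j by rewrite /T' (qr_star_intertwine _ VV qr).
rewrite mxE [X in _ = X -> _]mxE [X in _ = X -> _]big1 => [|l _]; last first.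
  have [li|il] := ltnP l i; first by rewrite (qr_star_trig qr) // mul0r.
  by rewrite [T l j]tri ?mulr0 // (leq_trans ji il) orbT.
rewrite (bigD1 j) //= big1 ?addr0 => [/eqP|l lj].
  by rewrite mulf_eq0 (gt_eqF (pU _ jm)) orbF => /eqP.
have [jl|] := ltnP j l; first by rewrite (qr_star_trig qr) // mulr0.
rewrite leq_eqVlt => /orP[/eqP/val_inj/eqP|lj']; first by rewrite (negbTE lj).
by rewrite IH ?mul0r ?(leq_trans lj') // (leq_trans _ ji) // ltnS ltnW.
Qed.

End Step.

(** * Contraction of the corner *)

Section Deflation.
Set Implicit Arguments.
Unset Strict Implicit.
Context {R : realType}.

Definition eigen_gap n (lam : 'I_n -> R) (g : R) :=
  0 < g /\ forall j k, j != k -> g <= `|lam j - lam k|.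

Lemma eigen_gap_inj n (lam : 'I_n -> R) g : eigen_gap lam g -> injective lam.
Proof.
move=> [g0 gap] j k jk; apply/eqP/negPn/negP => /gap.
by rewrite jk subrr normr0 leNgt g0.
Qed.

Definition sqr_shift n (c : R) (T : 'M[R]_n) : 'M[R]_n := (T - c%:M) *m (T - c%:M).

Lemma sqr_shift_spec_mx n (V : 'M[R]_n) lam c l m : V *m V^T = 1%:M ->
  sqr_shift c (spec_mx V lam) l m = \sum_j (lam j - c) ^+ 2 * V j l * V j m.
Proof.
move=> VV; rewrite /sqr_shift spec_mx_sub_scalar // spec_mxM // spec_mxE.
by apply: eq_bigr => j _; rewrite expr2.
Qed.

Lemma sqr_shift_diag n (T : 'M[R]_n) c l : T^T = T ->
  sqr_shift c T l l = \sum_m ((T - c%:M) l m) ^+ 2.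
Proof.
move=> sT; rewrite mxE; apply: eq_bigr => m _; rewrite expr2; congr (_ * _).
by rewrite -{1}sT !mxE eq_sym.
Qed.

(** The bottom right entry of (T - c)^2 ([sqr_shift_corner]): it dominates both
    b(T)^2 and (T_nn - c)^2, and it is a weighted sum over eigenvalues. *)
Definition corner_defect n (c : R) (T : 'M[R]_n.+2) := b T ^+ 2 + (T ord_max ord_max - c) ^+ 2.

Lemma corner_defect_ge0 n c (T : 'M[R]_n.+2) : 0 <= corner_defect c T.
Proof. by rewrite addr_ge0 ?sqr_ge0. Qed.

Lemma inord_neq_ord_max n : (inord n : 'I_n.+2) != ord_max.
Proof. by rewrite -val_eqE /= inordK // neq_ltn ltnSn. Qed.

Lemma sqr_shift_corner n (T : 'M[R]_n.+2) c : T^T = T -> tridiagonal T ->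
  sqr_shift c T ord_max ord_max = corner_defect c T.
Proof.
move=> sT tri; rewrite sqr_shift_diag // (bigD1 ord_max) //= (bigD1 (inord n)) ?inord_neq_ord_max //=.
rewrite big1 ?addr0 => [|m /andP[m1 m2]].
  by rewrite !mxE eqxx eq_sym (negbTE (inord_neq_ord_max n)) mulr1n mulr0n subr0 addrC.
rewrite !mxE eq_sym (negbTE m1) mulr0n subr0 tri ?expr0n //; apply/orP; right.
have mn : (m < n.+1)%N.
  by rewrite ltn_neqAle -ltnS ltn_ord andbT; apply: contra m1 => /eqP h; apply/eqP/val_inj.
rewrite /= ltnS ltn_neqAle -ltnS mn andbT; apply: contra m2 => /eqP h.
by apply/eqP/val_inj; rewrite /= inordK // h.
Qed.

Lemma corner_defect_weights n (V : 'M[R]_n.+2) lam c : V *m V^T = 1%:M ->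
  tridiagonal (spec_mx V lam) ->
  corner_defect c (spec_mx V lam) = \sum_j (lam j - c) ^+ 2 * V j ord_max ^+ 2.
Proof.
move=> VV tri; rewrite -sqr_shift_corner ?spec_mx_sym // sqr_shift_spec_mx //.
by apply: eq_bigr => j _; rewrite -mulrA expr2.
Qed.

(** If the defect is small, the last basis vector is nearly an eigenvector: all
    terms of the weighted sum but the [i]-th carry a factor at least g^2. *)
Lemma weight_concentration n (lam w : 'I_n -> R) g i : eigen_gap lam g ->
  \sum_j w j ^+ 2 = 1 ->
  g ^+ 2 * (1 - w i ^+ 2) <= \sum_j (lam j - lam i) ^+ 2 * w j ^+ 2.
Proof.
move=> [g0 gap] w1; rewrite -w1 (bigD1 i) //= addrAC subrr add0r [leRHS](bigD1 i) //=.
rewrite subrr expr0n mul0r add0r mulr_sumr; apply: ler_sum => j ji.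
apply: ler_wpM2r; first exact: sqr_ge0.
by rewrite -[leRHS]real_normK ?num_real // lerXn2r ?nnegrE ?(ltW g0) // gap.
Qed.

(** Inverse iteration damps the weights away from [i]: for j <> i the divisor
    lam j - s is at least g/2, while the dominating weight forces |r| = O(|s - lam i|). *)
Lemma weight_contraction n (lam w w' : 'I_n -> R) g i s r : eigen_gap lam g ->
  \sum_j w j ^+ 2 = 1 -> \sum_j w' j ^+ 2 = 1 ->
  (forall j, (lam j - s) * w' j = r * w j) ->
  `|s - lam i| <= g / 2 ->
  2 * \sum_j (lam j - lam i) ^+ 2 * w j ^+ 2 <= g ^+ 2 ->
  \sum_j (lam j - lam i) ^+ 2 * w' j ^+ 2 <=
    8 / g ^+ 2 * (s - lam i) ^+ 2 * \sum_j (lam j - lam i) ^+ 2 * w j ^+ 2.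
Proof.
move=> eg w1 w'1 step sg E; have [g0 gap] := eg.
have g20 : 0 < g ^+ 2 by rewrite exprn_gt0.
have wi : 1 / 2 <= w i ^+ 2.
  have := weight_concentration i eg w1.
  set S := \sum_j _ in E * => h; rewrite -(ler_pM2l g20); lra.
have w'i : w' i ^+ 2 <= 1.
  by rewrite -w'1 (bigD1 i) //= lerDl sumr_ge0 // => j _; apply: sqr_ge0.
have r2 : r ^+ 2 <= 2 * (s - lam i) ^+ 2.
  have h : r ^+ 2 * w i ^+ 2 = (s - lam i) ^+ 2 * w' i ^+ 2.
    by rewrite -!exprMn -step !exprMn; ring.
  have : r ^+ 2 * w i ^+ 2 <= (s - lam i) ^+ 2.
    by rewrite h ler_piMr ?sqr_ge0.
  have : r ^+ 2 * (1 / 2) <= r ^+ 2 * w i ^+ 2 by rewrite ler_wpM2l ?sqr_ge0.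
  lra.
rewrite mulr_sumr; apply: ler_sum => j _.
have [->|ji] := eqVneq j i; first by rewrite subrr expr0n /= !mul0r mulr0.
rewrite [leRHS]mulrCA; apply: ler_wpM2l; first exact: sqr_ge0.
have ls : g / 2 <= `|lam j - s|.
  have := gap j i ji; have := ler_distD s (lam j) (lam i); lra.
have ls2 : g ^+ 2 / 4 <= (lam j - s) ^+ 2.
  rewrite -[leRHS]real_normK ?num_real //.
  rewrite (_ : g ^+ 2 / 4 = (g / 2) ^+ 2); last by field.
  by rewrite lerXn2r ?nnegrE // divr_ge0 // ltW.
have h : (lam j - s) ^+ 2 * w' j ^+ 2 = r ^+ 2 * w j ^+ 2 by rewrite -!exprMn step.
have h1 : g ^+ 2 / 4 * w' j ^+ 2 <= 2 * (s - lam i) ^+ 2 * w j ^+ 2.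
  apply: (@le_trans _ _ ((lam j - s) ^+ 2 * w' j ^+ 2)).
    by rewrite ler_wpM2r ?sqr_ge0.
  by rewrite h ler_wpM2r ?sqr_ge0.
rewrite (_ : 8 / g ^+ 2 * _ * _ = (2 * (s - lam i) ^+ 2 * w j ^+ 2) / (g ^+ 2 / 4)).
  by rewrite ler_pdivlMr ?divr_gt0 // mulrC.
by field; rewrite gt_eqF.
Qed.

Lemma shift_step n (lam : 'I_n.+2 -> R) g (T : 'M[R]_n.+2) s i :
  eigen_gap lam g -> TLambda lam T -> `|s - lam i| <= g / 2 ->
  2 * corner_defect (lam i) T <= g ^+ 2 ->
  kernel_avoids (T - s%:M) /\
  (forall Q U, qr_star (T - s%:M) Q U -> TLambda lam (Q^T *m T *m Q) /\
    corner_defect (lam i) (Q^T *m T *m Q) <= 8 / g ^+ 2 * (s - lam i) ^+ 2 * corner_defect (lam i) T).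
Proof.
move=> eg TL sg; have [g0 gap] := eg; have lamI := eigen_gap_inj eg.
have [tri [V VV TE]] := (TLambdaP T lamI).1 TL; subst T.
rewrite spec_mx_sub_scalar // corner_defect_weights // => E; split.
  apply: (@kernel_avoids_spec_mx _ _ _ _ i) => // [j ji|].
    apply/eqP => ls; have := gap j i ji; have := ler_distD s (lam j) (lam i).
    rewrite ls normr0; lra.
  apply/eqP => Vi; have := weight_concentration i eg (orth_col_sqr ord_max VV).
  rewrite Vi expr0n /= subr0 mulr1 => h; have := exprn_gt0 2 g0; lra.
move=> Q U qr; rewrite -spec_mx_mul; have VV' := qr_star_orth VV qr.
have tri' := qr_star_tridiagonal VV qr tri.
split; first by apply/TLambdaP => //; split => //; exists (V *m Q).
rewrite corner_defect_weights //; apply: weight_contraction E => //.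
- exact: orth_col_sqr.
- exact: orth_col_sqr.
- exact: qr_star_last qr.
Qed.

End Deflation.

(** * A Lyapunov function for QR steps *)

Section Lyapunov.
Set Implicit Arguments.
Unset Strict Implicit.
Context {R : realType} {n : nat}.
Implicit Types (V Q U M T : 'M[R]_n.+1) (f lam : 'I_n.+1 -> R).

Definition upper_mass U := \sum_(l < n.+1) \sum_(m : 'I_n.+1 | (l < m)%N) U l m ^+ 2.

Lemma upper_mass_ge0 U : 0 <= upper_mass U.
Proof. by apply: sumr_ge0 => l _; apply: sumr_ge0 => m _; apply: sqr_ge0. Qed.

Lemma upper_entry_le U (l m : 'I_n.+1) : (l < m)%N -> U l m ^+ 2 <= upper_mass U.
Proof.
move=> lm; rewrite /upper_mass (bigD1 l) //= (bigD1 m) //= -addrA lerDl addr_ge0 //.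
  by apply: sumr_ge0 => k _; apply: sqr_ge0.
by apply: sumr_ge0 => l' _; apply: sumr_ge0 => m' _; apply: sqr_ge0.
Qed.

Lemma gramE U l : (U^T *m U) l l = \sum_m U m l ^+ 2.
Proof. by rewrite mxE; apply: eq_bigr => m _; rewrite mxE expr2. Qed.

Lemma cogramE U l : (U *m U^T) l l = \sum_m U l m ^+ 2.
Proof. by rewrite mxE; apply: eq_bigr => m _; rewrite mxE expr2. Qed.

(** Entry U l m contributes to the diagonal position m of U^T U and to the position
    l of U U^T, so the swap moves its square up by m - l >= 1 positions when l < m. *)
Lemma gram_swap_le U : (forall l m : 'I_n.+1, (m < l)%N -> U l m = 0) ->
  upper_mass U + \sum_(l < n.+1) l%:R * (U *m U^T) l l <=
  \sum_(l < n.+1) l%:R * (U^T *m U) l l.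
Proof.
move=> tU.
have -> : \sum_(l < n.+1) l%:R * (U^T *m U) l l =
    \sum_(l < n.+1) \sum_(m < n.+1) m%:R * U l m ^+ 2.
  rewrite exchange_big; apply: eq_bigr => l _.
  by rewrite gramE mulr_sumr.
rewrite -big_split /=; apply: ler_sum => l _.
rewrite cogramE mulr_sumr [X in X + _]big_mkcond -big_split /=.
apply: ler_sum => m _; case: ltnP => lm.
  by rewrite -[X in X + _]mul1r -mulrDl ler_wpM2r ?sqr_ge0 // nat1r ler_nat.
rewrite add0r; have [ml|ml] := ltnP m l; first by rewrite tU // expr0n mulr0 mulr0.
by rewrite ler_wpM2r ?sqr_ge0 // ler_nat.
Qed.

Lemma gram_swap_diag U l : (forall l m : 'I_n.+1, (m < l)%N -> U l m = 0) ->
  `|(U *m U^T) l l - (U^T *m U) l l| <= upper_mass U.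
Proof.
move=> tU.
pose up := \sum_(m : 'I_n.+1 | (l < m)%N) U l m ^+ 2.
pose dn := \sum_(m : 'I_n.+1 | (m < l)%N) U m l ^+ 2.
have -> : (U *m U^T) l l = U l l ^+ 2 + up.
  rewrite cogramE (bigID (fun m : 'I_n.+1 => (l < m)%N)) /= addrC; congr (_ + _).
  rewrite (bigD1 l) ?ltnn //= big1 ?addr0 // => m /andP[lm ml].
  rewrite tU ?expr0n // ltn_neqAle leqNgt lm andbT.
  by apply: contra ml => /eqP h; apply/eqP/val_inj.
have -> : (U^T *m U) l l = U l l ^+ 2 + dn.
  rewrite gramE (bigID (fun m : 'I_n.+1 => (m < l)%N)) /= addrC; congr (_ + _).
  rewrite (bigD1 l) ?ltnn //= big1 ?addr0 // => m /andP[lm ml].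
  rewrite tU ?expr0n // ltn_neqAle leqNgt lm andbT.
  by apply: contra ml => /eqP h; apply/eqP/val_inj.
have up0 : 0 <= up by apply: sumr_ge0 => m _; apply: sqr_ge0.
have dn0 : 0 <= dn by apply: sumr_ge0 => m _; apply: sqr_ge0.
have upU : up <= upper_mass U.
  rewrite /upper_mass (bigD1 l) //= lerDl; apply: sumr_ge0 => k _.
  by apply: sumr_ge0 => m _; apply: sqr_ge0.
have dnU : dn <= upper_mass U.
  rewrite /dn big_mkcond /=; apply: ler_sum => k _; case: ifP => kl.
    by rewrite (bigD1 l) //= lerDl; apply: sumr_ge0 => m _; apply: sqr_ge0.
  by apply: sumr_ge0 => m _; apply: sqr_ge0.
by rewrite ler_norml; apply/andP; split; lra.
Qed.

Lemma sqr_shift_conj T Q s : Q^T *m Q = 1%:M ->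
  sqr_shift s (Q^T *m T *m Q) = Q^T *m sqr_shift s T *m Q.
Proof.
move=> QQ; rewrite /sqr_shift.
have -> : Q^T *m T *m Q - s%:M = Q^T *m (T - s%:M) *m Q.
  by rewrite mulmxBr mulmxBl mul_mx_scalar -scalemxAl QQ scalemx1.
by rewrite !mulmxA -(mulmxA _ Q Q^T) (mulmx1C QQ) mulmx1.
Qed.

Definition lyapunov c T := \sum_(l < n.+1) l%:R * sqr_shift c T l l.

Lemma lyapunov_step V lam s Q U : V *m V^T = 1%:M -> qr_star (spec_mx V lam - s%:M) Q U ->
  upper_mass U + lyapunov s (Q^T *m spec_mx V lam *m Q) <= lyapunov s (spec_mx V lam).
Proof.
move=> VV; set T := spec_mx V lam => qr.
have sM : (T - s%:M)^T = T - s%:M by rewrite spec_mx_sub_scalar ?spec_mx_sym.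
have [_ [QQ _] _ _] := qr.
have -> : lyapunov s T = \sum_(l < n.+1) l%:R * (U^T *m U) l l.
  by rewrite (qr_star_gram qr).
have -> : lyapunov s (Q^T *m T *m Q) = \sum_(l < n.+1) l%:R * (U *m U^T) l l.
  by rewrite (qr_star_cogram qr) // /lyapunov sqr_shift_conj.
exact/gram_swap_le/qr_star_trig/qr.
Qed.

Lemma sqr_shift_change T s c l :
  sqr_shift s T l l = sqr_shift c T l l - 2 * (s - c) * (T l l - c) + (s - c) ^+ 2.
Proof.
rewrite /sqr_shift; have -> : T - s%:M = (T - c%:M) - (s - c)%:M.
  by rewrite raddfB /= opprB addrA subrK.
rewrite mulmxBr !mulmxBl -scalar_mxM !mul_mx_scalar !mul_scalar_mx.
by rewrite !mxE eqxx !mulr1n; set S := \sum_(_ | _) _; ring.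
Qed.

Lemma spec_mx_entry_le V lam l m : V *m V^T = 1%:M -> `|spec_mx V lam l m| <= \sum_j `|lam j|.
Proof.
move=> VV; rewrite spec_mxE; apply: le_trans (ler_norm_sum _ _ _) _.
apply: ler_sum => j _; rewrite -mulrA normrM ler_piMr // normrM.
by rewrite mulr_ile1 ?orth_le1.
Qed.

Lemma lyapunov_ge0 V lam c : V *m V^T = 1%:M -> 0 <= lyapunov c (spec_mx V lam).
Proof.
move=> VV; apply: sumr_ge0 => l _; apply: mulr_ge0 => //.
by rewrite sqr_shift_diag ?spec_mx_sym // sumr_ge0 // => m _; apply: sqr_ge0.
Qed.

Lemma lyapunov_le V lam c : V *m V^T = 1%:M ->
  lyapunov c (spec_mx V lam) <= \sum_(l < n.+1) l%:R * \sum_j (lam j - c) ^+ 2.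
Proof.
move=> VV; apply: ler_sum => l _; apply: ler_wpM2l => //.
rewrite sqr_shift_spec_mx //; apply: ler_sum => j _; rewrite -mulrA -expr2.
by rewrite ler_piMr ?sqr_ge0 ?orth_sqr_le1.
Qed.

(** A Lipschitz constant, in the shift, for the decrease of [lyapunov] in one step. *)
Definition lyapunov_lip lam := 2 * \sum_(l < n.+1) l%:R * (2 * \sum_j `|lam j|).

(** The Lyapunov function is taken at a fixed [c] while the step uses a shift [s] that
    varies along the orbit; the identity (T - s)^2 = (T - c)^2 - 2 (s - c)(T - c) + (s - c)^2
    makes the discrepancy linear in s - c. *)
Lemma lyapunov_decrease V lam c s Q U :
  V *m V^T = 1%:M -> qr_star (spec_mx V lam - s%:M) Q U ->
  upper_mass U <= lyapunov c (spec_mx V lam) - lyapunov c (Q^T *m spec_mx V lam *m Q)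
    + `|s - c| * lyapunov_lip lam.
Proof.
move=> VV qr; have := lyapunov_step VV qr.
set T := spec_mx V lam; set T' := Q^T *m T *m Q => h.
have change : lyapunov s T - lyapunov s T' =
    lyapunov c T - lyapunov c T' - (s - c) * (2 * \sum_(l < n.+1) l%:R * (T l l - T' l l)).
  rewrite /lyapunov -!sumrB !mulr_sumr -sumrB; apply: eq_bigr => l _.
  by rewrite (sqr_shift_change T s c) (sqr_shift_change T' s c); ring.
have bound : `|2 * \sum_(l < n.+1) l%:R * (T l l - T' l l)| <= lyapunov_lip lam.
  rewrite normrM ger0_norm // ler_pM2l //; apply: le_trans (ler_norm_sum _ _ _) _.
  apply: ler_sum => l _; rewrite normrM ger0_norm //; apply: ler_wpM2l => //.
  apply: le_trans (ler_normB _ _) _.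
  have := spec_mx_entry_le lam l l VV; have := spec_mx_entry_le lam l l (qr_star_orth VV qr).
  rewrite spec_mx_mul -/T -/T'; lra.
have : - ((s - c) * (2 * \sum_(l < n.+1) l%:R * (T l l - T' l l))) <= `|s - c| * lyapunov_lip lam.
  rewrite -mulrN; apply: le_trans (ler_norm _) _; rewrite normrM normrN.
  by rewrite ler_wpM2l.
by move: change h; set W := (s - c) * _; lra.
Qed.

End Lyapunov.

(** * Triangular factors close to diagonal *)

Section NearDiagonal.
Set Implicit Arguments.
Unset Strict Implicit.
Context {R : realType} {n : nat}.
Implicit Types (V Q U M T : 'M[R]_n.+1) (f lam : 'I_n.+1 -> R) (p : 'I_n.+1 -> 'I_n.+1).

Let N : R := n.+1%:R.
Let N1 : 1 <= N. Proof. by rewrite /N ler1n. Qed.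

Lemma sum_le_const (F : 'I_n.+1 -> R) c : (forall j, F j <= c) -> \sum_j F j <= N * c.
Proof.
move=> h; apply: (@le_trans _ _ (\sum_(j < n.+1) c)); first exact: ler_sum.
by rewrite sumr_const card_ord mulr_natl.
Qed.

Definition near_diag lam p d T :=
  forall l m, `|T l m - (l == m)%:R * lam (p l)| <= d.

(** A column of an orthogonal matrix has norm 1, so each column has one entry of
    square at least 3/4.  Two columns cannot have it in the same row, which
    also has norm 1. *)
Lemma localized_columns V th : V *m V^T = 1%:M -> 0 <= th -> th * (2 * N) <= 1 ->
  (forall l, exists j, forall k, k != j -> `|V k l| <= th) ->
  exists2 p, injective p & forall l k, k != p l -> `|V k l| <= th.
Proof.
move=> VV th0 thN /fin_all_exists [p pP]; exists p => //.
have th2 : N * th ^+ 2 <= 1 / 4.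
  have h1 : th * N <= 1 / 2 by lra.
  have h2 : th <= 1 / 2 by apply: le_trans h1; rewrite ler_peMr.
  rewrite expr2 mulrA [N * th]mulrC.
  apply: (@le_trans _ _ (1 / 2 * (1 / 2))); last by lra.
  by apply: ler_pM => //; rewrite mulr_ge0 // (le_trans _ N1).
have big l : 3 / 4 <= V (p l) l ^+ 2.
  have := orth_col_sqr l VV; rewrite (bigD1 (p l)) //=.
  have : \sum_(j < n.+1 | j != p l) V j l ^+ 2 <= N * th ^+ 2.
    rewrite big_mkcond; apply: sum_le_const => j; case: ifP => jp; last exact: sqr_ge0.
    by rewrite -[leLHS]real_normK ?num_real // lerXn2r ?nnegrE // pP.
  lra.
move=> l l' pl; apply/eqP/negPn/negP => ll'.
have := orth_row_sqr (p l) VV; rewrite (bigD1 l) //= (bigD1 l') /= 1?eq_sym //.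
have := big l; have := big l'; rewrite -pl.
have : 0 <= \sum_(i < n.+1 | (i != l) && (i != l')) V (p l) i ^+ 2.
  by apply: sumr_ge0 => i _; apply: sqr_ge0.
lra.
Qed.

Lemma localized_near_diag V lam th p s B : V *m V^T = 1%:M -> 0 <= th -> th <= 1 ->
  (forall j, `|lam j - s| <= B) ->
  (forall l k, k != p l -> `|V k l| <= th) -> injective p ->
  near_diag lam p (2 * N * B * th) (spec_mx V lam).
Proof.
move=> VV th0 th1 lB loc pI l m; have B0 : 0 <= B by apply: le_trans (lB ord0).
have [<-|lm] := eqVneq l m.
  rewrite mul1r; have -> : spec_mx V lam l l - lam (p l) =
      \sum_j (lam j - lam (p l)) * V j l ^+ 2.
    rewrite spec_mxE; under [RHS]eq_bigr do rewrite mulrBl.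
    rewrite sumrB -mulr_sumr (orth_col_sqr l VV) mulr1; congr (_ - _).
    by apply: eq_bigr => j _; rewrite expr2 mulrA.
  apply: le_trans (ler_norm_sum _ _ _) _.
  rewrite (_ : 2 * N * B * th = N * (2 * B * th)); last by ring.
  apply: sum_le_const => j; have [->|jp] := eqVneq j (p l).
    by rewrite subrr mul0r normr0 !mulr_ge0.
  rewrite normrM normrX; apply: ler_pM => //.
    have := lB j; have := lB (p l); have := ler_distD s (lam j) (lam (p l)).
    rewrite (distrC s); lra.
  have := loc l j jp => h; rewrite expr2; apply: le_trans (ler_pM _ _ h h) _ => //.
  by rewrite ler_piMr.
rewrite mul0r subr0; have -> : spec_mx V lam l m = \sum_j (lam j - s) * (V j l * V j m).
  rewrite spec_mxE; under [RHS]eq_bigr do rewrite mulrBl.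
  rewrite sumrB -mulr_sumr (orth_cols l m VV) (negbTE lm) mulr0 subr0.
  by apply: eq_bigr => j _; rewrite mulrA.
apply: le_trans (ler_norm_sum _ _ _) _.
apply: (@le_trans _ _ (N * (B * th))); last first.
  by rewrite mulrA -!mulrA ler_peMl ?ler1n // !mulr_ge0 // (le_trans _ N1).
apply: sum_le_const => j; rewrite !normrM; apply: ler_pM => //.
have [jl|jl] := eqVneq j (p l).
  rewrite -[leRHS]mul1r; apply: ler_pM => //; first exact: orth_le1.
  by apply: loc; rewrite jl; apply: contra lm => /eqP/pI ->.
by rewrite -[leRHS]mulr1; apply: ler_pM => //; [exact: loc|exact: orth_le1].
Qed.

Lemma gram_offdiag U B t l m : l != m -> 0 <= B ->
  (forall l m : 'I_n.+1, (m < l)%N -> U l m = 0) ->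
  (forall k l, `|U k l| <= B) -> (forall k l : 'I_n.+1, (k < l)%N -> `|U k l| <= t) ->
  0 <= t -> `|(U^T *m U) l m| <= N * (B * t).
Proof.
move=> lm B0 tU UB Ut t0; rewrite mxE; apply: le_trans (ler_norm_sum _ _ _) _.
apply: sum_le_const => k; rewrite mxE normrM.
have [kl|lk] := ltnP k l.
  by rewrite mulrC; apply: ler_pM => //; exact: Ut.
have [km|mk] := ltnP k m; first by apply: ler_pM => //; exact: Ut.
move: lk; rewrite leq_eqVlt => /orP[/eqP/val_inj kl|lk]; last first.
  by rewrite tU // normr0 mul0r mulr_ge0.
rewrite (tU k m) ?normr0 ?mulr0 ?mulr_ge0 //.
by rewrite ltn_neqAle mk andbT; apply: contra lm => /eqP mk'; apply/eqP/val_inj; rewrite /= mk' kl.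
Qed.

(** Read at position l, the eigenvector equation for row k of [V] says that
    x k - X l l or V k l is small; by separation, the former happens for at most one k. *)
Lemma eigenvector_localized V x X G tau l : (forall j k, j != k -> G <= `|x j - x k|) ->
  0 < G -> V *m V^T = 1%:M ->
  V *m X = diag_mx (\row_j x j) *m V -> (forall m, m != l -> `|X m l| <= tau) -> 0 <= tau ->
  exists j, forall k, k != j -> `|V k l| <= 2 * (N * tau) / G.
Proof.
move=> sep G0 VV VX Xl tau0.
have key j : `|x j - X l l| * `|V j l| <= N * tau.
  move/matrixP: VX => /(_ j l); rewrite mul_diagE mxE (bigD1 l) //= => h.
  have -> : `|x j - X l l| * `|V j l| = `|\sum_(i < n.+1 | i != l) V j i * X i l|.
    by rewrite -normrM mulrBl -h [X l l * _]mulrC addrAC subrr add0r.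
  rewrite big_mkcond; apply: le_trans (ler_norm_sum _ _ _) _; apply: sum_le_const => i.
  case: ifP => il; last by rewrite normr0.
  rewrite normrM -[leRHS]mul1r; apply: ler_pM => //; [exact: orth_le1|exact: Xl].
have small k : G / 2 <= `|x k - X l l| -> `|V k l| <= 2 * (N * tau) / G.
  move=> h; rewrite ler_pdivlMr // mulrC.
  suff : G / 2 * `|V k l| <= N * tau by lra.
  by apply: le_trans (key k); apply: ler_wpM2r.
have [[j jP]|h] := pselect (exists j, `|x j - X l l| < G / 2).
  exists j => k kj; apply: small; have := sep k j kj.
  have := ler_distD (X l l) (x k) (x j); rewrite (distrC (X l l)); lra.
exists ord0 => k _; apply: small; rewrite leNgt; apply/negP => hk.
by apply: h; exists k.
Qed.

(** A small strictly upper part of [U] makes U^T U = (T - s)^2 almost diagonal.  Its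
    simple spectrum localizes its eigenvectors, which are those of T.  Separation of
    the squares is essential: T - s could be a reflection, for which [U] is diagonal
    and T is not. *)
Lemma small_upper_mass_near_diag lam (G B d : R) : 0 < G -> 0 < B -> 0 < d ->
  exists2 eta, 0 < eta & forall V s Q U, V *m V^T = 1%:M ->
    (forall j k, j != k -> G <= `|(lam j - s) ^+ 2 - (lam k - s) ^+ 2|) ->
    (forall j, `|lam j - s| <= B) ->
    qr_star (spec_mx V lam - s%:M) Q U -> upper_mass U <= eta ->
    exists2 p, injective p & near_diag lam p d (spec_mx V lam).
Proof.
move=> G0 B0 d0; have N0 : 0 < N by apply: lt_le_trans N1.
(* The localization required of the eigenvectors; t is the matching bound on the
   strictly upper entries of U. *)
pose th := Num.min (2 * N)^-1 (d / (2 * N * B)).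
have th0 : 0 < th by rewrite lt_min invr_gt0 mulr_gt0 ?divr_gt0 ?mulr_gt0.
have thN : th * (2 * N) <= 1.
  by rewrite -ler_pdivlMr ?mulr_gt0 // div1r ge_min lexx.
have thd : 2 * N * B * th <= d.
  by rewrite mulrC -ler_pdivlMr ?mulr_gt0 // ge_min lexx orbT.
have th1 : th <= 1.
  apply: le_trans thN; rewrite ler_peMr ?(ltW th0) //; have := N1; lra.
pose t := th * G / (2 * N * (N * B)).
have t0 : 0 < t by rewrite divr_gt0 ?mulr_gt0.
have tE : 2 * (N * (N * (B * t))) / G = th.
  by rewrite /t; field; rewrite !gt_eqF.
exists (t ^+ 2); first by rewrite exprn_gt0.
move=> V s Q U VV sep lB qr Ut.
have tU := qr_star_trig qr.
have Ut' (k l : 'I_n.+1) : (k < l)%N -> `|U k l| <= t.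
  move=> kl; rewrite -(@ler_pXn2r _ 2) ?nnegrE // ?(ltW t0) // real_normK ?num_real //.
  exact: le_trans (upper_entry_le _ kl) Ut.
move: qr; rewrite spec_mx_sub_scalar // => qr.
have XE := qr_star_gram qr (spec_mx_sym _ _).
have UB k l : `|U k l| <= B.
  rewrite -(@ler_pXn2r _ 2) ?nnegrE // ?(ltW B0) // real_normK ?num_real //.
  apply: (@le_trans _ _ ((U^T *m U) l l)).
    by rewrite gramE (bigD1 k) //= lerDl sumr_ge0 // => i _; apply: sqr_ge0.
  rewrite XE spec_mxM // spec_mxE -[leRHS]mulr1 -(orth_col_sqr l VV) mulr_sumr.
  apply: ler_sum => j _; rewrite -mulrA -!expr2 ler_wpM2r ?sqr_ge0 //.
  by rewrite -[leLHS]real_normK ?num_real // lerXn2r ?nnegrE // ltW.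
have [p pI loc] : exists2 p, injective p & forall l k, k != p l -> `|V k l| <= th.
  apply: localized_columns => //; first exact: ltW.
  move=> l; rewrite -tE; apply: (@eigenvector_localized _ _ (U^T *m U)) sep _ _ _ _ _ => //.
  - by rewrite XE spec_mxM // mul_spec_mx.
  - by move=> m ml; apply: gram_offdiag => //; rewrite ltW.
  - by apply: mulr_ge0; [exact: ltW|apply: mulr_ge0; exact: ltW].
exists p => // l m; apply: le_trans thd.
exact: (localized_near_diag VV (ltW th0) th1 lB).
Qed.

Lemma near_diag_sqr_shift lam p d T s B l : T^T = T -> 0 <= d -> d <= 1 -> near_diag lam p d T ->
  (forall j, `|lam j - s| <= B) ->
  `|sqr_shift s T l l - (lam (p l) - s) ^+ 2| <= d * (2 * B + 1 + N).
Proof.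
move=> sT d0 d1 nT lB; rewrite sqr_shift_diag // (bigD1 l) //=.
rewrite mulrDr addrAC; apply: le_trans (ler_normD _ _) _; apply: lerD.
  have := nT l l; rewrite eqxx mul1r => h.
  rewrite subr_sqr normrM !mxE eqxx mulr1n opprB addrA subrK; apply: ler_pM => //.
  have -> : T l l - s + (lam (p l) - s) = (T l l - lam (p l)) + 2 * (lam (p l) - s) by ring.
  apply: le_trans (ler_normD _ _) _; rewrite normrM (ger0_norm (ler0n _ 2)).
  have := lB (p l); lra.
apply: le_trans (ler_norm_sum _ _ _) _; rewrite mulrC big_mkcond; apply: sum_le_const => m.
case: ifP => ml //; have := nT l m; rewrite eq_sym (negbTE ml) mul0r subr0 => h.
rewrite !mxE eq_sym (negbTE ml) mulr0n subr0 normrX expr2.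
by apply: le_trans (ler_pM _ _ h h) _ => //; rewrite ler_piMr.
Qed.

End NearDiagonal.

(** * Exact deflation *)

Section ExactDeflation.
Set Implicit Arguments.
Unset Strict Implicit.
Context {R : realType}.

(** Row-by-row Cholesky factorization of 1 - x x^T, stated away from the last index,
    where x may be large.  Each row of [U] solves an equation perturbed by x x^T, of size xi, and
    by products of earlier off-diagonal entries, of size 16 n xi^2 <= xi. *)
Lemma cholesky_near_id n (U : 'M[R]_n.+1) (x : 'I_n.+1 -> R) xi :
  (forall l m : 'I_n.+1, (m < l)%N -> U l m = 0) ->
  (forall l : 'I_n.+1, l != ord_max -> 0 < U l l) ->
  (forall l m, (U^T *m U) l m = (l == m)%:R - x l * x m) ->
  (forall l, l != ord_max -> x l ^+ 2 <= xi) -> 16 * n.+1%:R * xi <= 1 -> 0 <= xi ->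
  forall l m : 'I_n.+1, l != ord_max -> m != ord_max -> `|U l m - (l == m)%:R| <= 4 * xi.
Proof.
move=> tU pU UU xle xi1 xi0.
have xi16 : 16 * xi <= 1.
  apply: le_trans xi1; rewrite ler_wpM2r // ler_peMr // ler1n //.
suff H k (l : 'I_n.+1) : (l < k)%N -> l != ord_max -> forall m, m != ord_max ->
    `|U l m - (l == m)%:R| <= 4 * xi.
  by move=> l m lM mM; apply: (H n.+1).
elim: k l => // k IH l lk lM m mM.
have [ml|lm] := ltnP m l.
  rewrite tU // (_ : (l == m) = false) ?subrr ?normr0 ?mulr_ge0 //.
  by apply/negP => /eqP h; move: ml; rewrite h ltnn.
have xx (a c : 'I_n.+1) : a != ord_max -> c != ord_max -> `|x a * x c| <= xi.
  move=> aM cM; rewrite -(@ler_pXn2r _ 2) ?nnegrE // real_normK ?num_real //.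
  rewrite exprMn expr2; apply: ler_pM; rewrite ?sqr_ge0 //; exact: xle.
have rec (c : 'I_n.+1) : (l <= c)%N -> c != ord_max ->
    `|(l == c)%:R - x l * x c - U l l * U l c| <= xi.
  move=> lc cM; rewrite -UU mxE (bigD1 l) //= mxE addrAC subrr add0r big_mkcond.
  apply: le_trans (ler_norm_sum _ _ _) _.
  apply: (@le_trans _ _ (n.+1%:R * (4 * xi * (4 * xi)))); last first.
    rewrite (_ : n.+1%:R * _ = 16 * n.+1%:R * xi * xi); last by ring.
    by rewrite ler_piMl.
  apply: sum_le_const => a; case: ifP => al; last by rewrite normr0 !mulr_ge0.
  rewrite mxE; have [la|] := ltnP l a; first by rewrite tU // mul0r normr0 !mulr_ge0.
  rewrite leq_eqVlt => /orP[/eqP/val_inj/eqP|al']; first by rewrite (negbTE al).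
  have aM : a != ord_max.
    by apply: contra lM => /eqP h; move: al'; rewrite h /= ltnNge -ltnS ltn_ord.
  have ne (e : 'I_n.+1) : (l <= e)%N -> (a == e) = false.
    by move=> le; apply/negP => /eqP h; move: al'; rewrite h ltnNge le.
  have ak : (a < k)%N by apply: leq_trans al' _; rewrite -ltnS.
  have := IH a ak aM l lM; have := IH a ak aM c cM; rewrite !ne // !subr0 => h1 h2.
  by rewrite normrM; apply: ler_pM.
have := rec l (leqnn _) lM; rewrite eqxx => rl.
have := xx l l lM lM; have := pU l lM => Ul0 xl.
have U1 : `|U l l - 1| <= 2 * xi.
  have : `|U l l - 1| * (1 + U l l) <= 2 * xi.
    rewrite -[1 + U l l]ger0_norm -?normrM; last by rewrite addr_ge0 // ltW.
    rewrite (_ : _ * _ = - ((1%:R - x l * x l - U l l * U l l) + x l * x l)); last by ring.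
    by rewrite normrN; apply: le_trans (ler_normD _ _) _; lra.
  by apply: le_trans; rewrite ler_peMr // lerDl ltW.
have [<-|lm'] := eqVneq l m; first by apply: le_trans U1 _; lra.
have U2 : 1 / 2 <= U l l by move: U1; rewrite ler_norml => /andP[h _]; lra.
rewrite subr0; have := rec m lm mM; rewrite (negbTE lm') sub0r => h.
have : `|U l l * U l m| <= 2 * xi.
  rewrite (_ : U l l * U l m = - ((- (x l * x m) - U l l * U l m) + x l * x m)); last by ring.
  by rewrite normrN; apply: le_trans (ler_normD _ _) _; have := xx l m lM mM; lra.
rewrite normrM (gtr0_norm Ul0) => h2.
have : 1 / 2 * `|U l m| <= U l l * `|U l m| by rewrite ler_wpM2r.
lra.
Qed.

Context {n : nat}.
Implicit Types (V Q U M T : 'M[R]_n.+2) (lam : 'I_n.+2 -> R).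

Definition corner_dir : 'M[R]_n.+2 :=
  delta_mx ord_max (inord n) + delta_mx (inord n) ord_max.

Lemma corner_part T l m : T^T = T -> tridiagonal T ->
  (b T *: corner_dir) l m = if (l == ord_max) (+) (m == ord_max) then T l m else 0.
Proof.
move=> sT tri; have pm := negbTE (inord_neq_ord_max n); have pm' := pm; rewrite eq_sym in pm'.
have far (k : 'I_n.+2) : k != ord_max -> k != inord n -> T ord_max k = 0.
  move=> kM kp; apply: tri; apply/orP; right.
  have kn : (k < n.+1)%N.
    by rewrite ltn_neqAle -ltnS ltn_ord andbT; apply: contra kM => /eqP h; apply/eqP/val_inj.
  rewrite /= ltnS ltn_neqAle -ltnS kn andbT; apply: contra kp => /eqP h.
  by apply/eqP/val_inj; rewrite /= inordK // h.
rewrite !mxE /b; have [->|lM] := eqVneq l ord_max; have [->|mM] := eqVneq m ord_max => /=.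
- by rewrite pm' addr0 mulr0.
- rewrite andbF addr0; have [->|mp] := eqVneq m (inord n); first by rewrite mulr1.
  by rewrite mulr0 far.
- rewrite add0r andbT -[in RHS]sT mxE; have [->|mp] := eqVneq l (inord n); first by rewrite mulr1.
  by rewrite mulr0 far.
- by rewrite andbF addr0 mulr0.
Qed.

Lemma corner_row_le T c m : T^T = T -> tridiagonal T -> m != ord_max ->
  T ord_max m ^+ 2 <= corner_defect c T.
Proof.
move=> sT tri mM; rewrite -sqr_shift_corner // sqr_shift_diag // (bigD1 m) //=.
rewrite !mxE eq_sym (negbTE mM) subr0 lerDl sumr_ge0 // => k _; exact: sqr_ge0.
Qed.

(** [T0] is the QR step for the projection 1 - v v^T killing the [i]-th eigenvector.
    As f i = 0, the recursion of [qr_star_last] has factor 0 on its right-hand side, so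
    all other weights of [T0] vanish and its defect is 0.  Away from the last
    index, [U] differs from 1 by O(xi) with xi the defect over g^2, and
    T0 - T = T0 (1 - U) + (U - 1) T; the last column of [U] is only O(sqrt xi) but
    multiplies the entry b, of the same size. *)
Lemma exact_deflation lam g : eigen_gap lam g ->
  exists2 c, 0 < c & forall i T, TLambda lam T ->
    16 * n.+2%:R * corner_defect (lam i) T <= g ^+ 2 ->
    exists T0, [/\ TLambda lam T0, corner_defect (lam i) T0 = 0 &
      forall l m, `|T0 l m - (T - b T *: corner_dir) l m| <= c * corner_defect (lam i) T].
Proof.
move=> eg; have [g0 gap] := eg; have lamI := eigen_gap_inj eg.
have g20 : 0 < g ^+ 2 by rewrite exprn_gt0.
pose L := \sum_j `|lam j|; have L0 : 0 <= L by apply: sumr_ge0.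
have lamL j : `|lam j| <= L by rewrite /L (bigD1 j) //= lerDl sumr_ge0.
have N1 : 1 <= n.+2%:R :> R by rewrite ler1n.
exists (n.+2%:R * (8 * L / g ^+ 2 + 1 / g)).
  rewrite mulr_gt0 // ltr_wpDl ?divr_gt0 // divr_ge0 ?mulr_ge0 // ltW //.
move=> i T TL; set E := corner_defect _ T => E16.
have [tri [V VV TE]] := (TLambdaP T lamI).1 TL.
have [sT _ _] := TL.
have E0 : 0 <= E by apply: corner_defect_ge0.
pose xi := E / g ^+ 2.
have xi0 : 0 <= xi by rewrite divr_ge0 // ltW.
have xi16 : 16 * n.+2%:R * xi <= 1 by rewrite /xi mulrA ler_pdivrMr // mul1r.
have xi1 : 16 * xi <= 1.
  by apply: le_trans xi16; rewrite ler_wpM2r // ler_peMr.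
have conc : 1 - V i ord_max ^+ 2 <= xi.
  rewrite ler_pdivlMr // mulrC /E TE corner_defect_weights -?TE //.
  exact: weight_concentration (orth_col_sqr ord_max VV).
pose f := fun j : 'I_n.+2 => (j != i)%:R : R.
have ME l m : spec_mx V f l m = (l == m)%:R - V i l * V i m.
  rewrite spec_mxE -(orth_cols l m VV) (bigD1 i) //= [X in _ = X - _](bigD1 i) //=.
  rewrite /f eqxx !mul0r add0r addrAC subrr add0r.
  by apply: eq_bigr => j ->; rewrite mul1r.
have MM : spec_mx V f *m spec_mx V f = spec_mx V f.
  rewrite spec_mxM //; congr spec_mx; apply/funext => j; rewrite /f.
  by case: (j != i); rewrite ?mulr1 ?mulr0.
have [Q [U qr]] : exists Q U, qr_star (spec_mx V f) Q U.
  apply/qr_star_exists/(@kernel_avoids_spec_mx _ _ _ _ i) => //.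
    by move=> j; rewrite /f => ->; rewrite oner_eq0.
  by apply/eqP => Vi; move: conc; rewrite Vi expr0n /= subr0; lra.
have tU := qr_star_trig qr.
have UU : U^T *m U = spec_mx V f by rewrite (qr_star_gram qr) ?spec_mx_sym.
have xle l : l != ord_max -> V i l ^+ 2 <= xi.
  move=> lM; apply: le_trans conc; have := orth_row_sqr i VV.
  rewrite (bigD1 ord_max) //= (bigD1 l) //=.
  have : 0 <= \sum_(k < n.+2 | (k != ord_max) && (k != l)) V i k ^+ 2.
    by apply: sumr_ge0 => k _; apply: sqr_ge0.
  lra.
have U1 (l m : 'I_n.+2) : l != ord_max -> m != ord_max -> `|U l m - (l == m)%:R| <= 4 * xi.
  apply: (cholesky_near_id (x := V i)) => //.
  - by move=> k; have [_ _ _] := qr; apply.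
  - by move=> k p; rewrite UU ME.
have Ulast l : U l ord_max ^+ 2 <= xi.
  apply: le_trans conc; have := gramE U ord_max; rewrite UU ME eqxx -expr2 => ->.
  by rewrite (bigD1 l) //= lerDl sumr_ge0 // => k _; apply: sqr_ge0.
pose W := V *m Q; have WW : W *m W^T = 1%:M := qr_star_orth VV qr.
pose T0 := spec_mx W lam.
have tri0 : tridiagonal T0 by apply: (qr_star_tridiagonal VV qr); rewrite -TE.
have T0L : TLambda lam T0 by apply/TLambdaP => //; split => //; exists W.
have [sT0 _ _] := T0L.
have T0defl : corner_defect (lam i) T0 = 0.
  have last := qr_star_last VV qr.
  have Umm : U ord_max ord_max = 0.
    have /esym/eqP := last i; rewrite /f eqxx mul0r mulf_eq0 => /orP[/eqP //|/eqP Vi].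
    by move: conc; rewrite Vi expr0n /= subr0; lra.
  rewrite corner_defect_weights // big1 // => j _; have [->|ji] := eqVneq j i.
    by rewrite subrr expr0n mul0r.
  by have := last j; rewrite /f ji mul1r Umm mul0r -/W => ->; rewrite expr0n mulr0.
have T0last l : l != ord_max -> T0 ord_max l = 0.
  move=> lM; have := corner_row_le (lam i) sT0 tri0 lM; rewrite T0defl => h.
  by apply/eqP; rewrite -sqrf_eq0 eq_le h sqr_ge0.
have T0last' l : l != ord_max -> T0 l ord_max = 0.
  by move=> lM; rewrite -sT0 mxE T0last.
exists T0; split => // l m; rewrite [X in _ - X]mxE [X in _ - (_ + X)]mxE corner_part //.
have Exi : E / g ^+ 2 = xi by [].
have cE : n.+2%:R * (8 * L / g ^+ 2 + 1 / g) * E = n.+2%:R * (8 * L * xi + E / g).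
  by rewrite /xi; field; rewrite gt_eqF.
have rhs0 : 0 <= 8 * L * xi + E / g by rewrite addr_ge0 ?mulr_ge0 // invr_ge0 ltW.
have Lxi0 : 0 <= 4 * L * xi by apply: mulr_ge0 => //; apply: mulr_ge0.
rewrite cE; have [lM|lM] := eqVneq l ord_max; have [mM|mM] := eqVneq m ord_max => /=.
- subst l m; rewrite subr0.
  have -> : T0 ord_max ord_max = lam i.
    apply/eqP; rewrite -subr_eq0 -sqrf_eq0 eq_le sqr_ge0 andbT -T0defl lerDr.
    exact: sqr_ge0.
  have -> : lam i - T ord_max ord_max = \sum_j (lam i - lam j) * V j ord_max ^+ 2.
    under eq_bigr do rewrite mulrBl.
    rewrite sumrB -mulr_sumr (orth_col_sqr _ VV) mulr1 TE spec_mxE; congr (_ - _).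
    by apply: eq_bigr => j _; rewrite expr2 mulrA.
  apply: le_trans (ler_norm_sum _ _ _) _; apply: sum_le_const => j.
  have [->|ji] := eqVneq j i; first by rewrite subrr mul0r normr0.
  have Vj : V j ord_max ^+ 2 <= xi.
    apply: le_trans conc; have := orth_col_sqr ord_max VV.
    rewrite (bigD1 i) //= (bigD1 j) //=.
    have : 0 <= \sum_(k < n.+2 | (k != i) && (k != j)) V k ord_max ^+ 2.
      by apply: sumr_ge0 => k _; apply: sqr_ge0.
    lra.
  rewrite normrM [X in _ * X]ger0_norm ?sqr_ge0 //.
  apply: (@le_trans _ _ (8 * L * xi)); last by rewrite lerDl divr_ge0 // ltW.
  apply: ler_pM => //; first exact: sqr_ge0.
  by apply: le_trans (ler_normB _ _) _; have := lamL i; have := lamL j; lra.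
- by rewrite lM T0last // !subrr normr0 mulr_ge0.
- by rewrite mM T0last' // !subrr normr0 mulr_ge0.
- rewrite subr0.
  have -> : T0 l m - T l m = (T0 *m (1%:M - U)) l m + ((U - 1%:M) *m T) l m.
    have TU : T0 *m U = U *m T by rewrite TE; apply: qr_star_intertwine VV qr.
    rewrite mulmxBr mulmxBl mulmx1 mul1mx TU !mxE; ring.
  apply: (@le_trans _ _ (n.+2%:R * (4 * L * xi) + n.+2%:R * (4 * L * xi + E / g))); last first.
    by rewrite -mulrDr ler_wpM2l //; lra.
  apply: le_trans (ler_normD _ _) _; apply: lerD; rewrite mxE.
    apply: le_trans (ler_norm_sum _ _ _) _; apply: sum_le_const => k.
    have [->|kM] := eqVneq k ord_max; first by rewrite T0last' // mul0r normr0.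
    rewrite normrM [4 * L]mulrC -mulrA; apply: ler_pM => //; first exact: spec_mx_entry_le.
    by rewrite !mxE distrC; apply: U1.
  apply: le_trans (ler_norm_sum _ _ _) _; apply: sum_le_const => k.
  have [->|kM] := eqVneq k ord_max.
    rewrite !mxE (negbTE lM) subr0.
    apply: (@le_trans _ _ (E / g)); last by rewrite lerDr.
    rewrite -(@ler_pXn2r _ 2) ?nnegrE ?divr_ge0 // ?(ltW g0) // real_normK ?num_real //.
    rewrite exprMn (_ : (E / g) ^+ 2 = xi * E); last first.
      by rewrite /xi; field; rewrite gt_eqF.
    by apply: ler_pM; rewrite ?sqr_ge0 //; apply: corner_row_le.
  apply: (@le_trans _ _ (4 * L * xi)); last by rewrite lerDl divr_ge0 // ltW.
  rewrite normrM [4 * L]mulrC -mulrA [leLHS]mulrC; apply: ler_pM => //.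
    by rewrite TE; exact: spec_mx_entry_le.
  by rewrite !mxE; apply: U1.
Qed.

End ExactDeflation.

(** * Second differences and Lipschitz bounds *)

Section Smooth.
Set Implicit Arguments.
Unset Strict Implicit.
Context {R : realType}.

Lemma is_derive_line (V : normedModType R) (g : V -> R) M W (t : R) :
  derivable g (M + t *: W) W ->
  is_derive t 1 (fun s => g (M + s *: W)) ('D_W g (M + t *: W)).
Proof.
move=> dg.
have E : (fun h : R => h^-1 *: (((fun s => g (M + s *: W)) \o shift t) (h *: (1 : R)) - g (M + t *: W)))
   = (fun h : R => h^-1 *: ((g \o shift (M + t *: W)) (h *: W) - g (M + t *: W))).
  apply/funext => h /=; congr (_ *: (g _ - _)).
  by rewrite scalerDl [h *: 1]mulr1 addrCA.
by split; rewrite /derivable /derive E.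
Qed.

Lemma mvt_line (V : normedModType R) (g : V -> R) M W (a c : R) : a < c ->
  (forall s, a <= s <= c -> derivable g (M + s *: W) W) ->
  exists2 s, a <= s <= c &
    g (M + c *: W) - g (M + a *: W) = 'D_W g (M + s *: W) * (c - a).
Proof.
move=> ac dg.
have [| |s sac E] := @MVT R (fun s => g (M + s *: W)) (fun s => 'D_W g (M + s *: W)) a c ac.
- by move=> s; rewrite in_itv /= => /andP[sa sc]; apply/is_derive_line/dg; rewrite !ltW.
- apply: derivable_within_continuous => s; rewrite in_itv /= => sac.
  by have [] := is_derive_line (dg s sac).
- by exists s => //; move: sac; rewrite in_itv /= => /andP[sa sc]; rewrite !ltW.
Qed.

(** Two applications of the mean value theorem to g and one to its derivative along
    [W]. *)
Lemma second_difference (V : normedModType R) (g : V -> R) M W (t B : R) : 0 <= t ->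
  (forall s, `|s| <= t -> [/\ derivable g (M + s *: W) W,
     derivable (fun x => 'D_W g x) (M + s *: W) W &
     `|'D_W (fun x => 'D_W g x) (M + s *: W)| <= B]) ->
  `|g (M + t *: W) + g (M + (- t) *: W) - 2 * g M| <= 2 * B * t ^+ 2.
Proof.
rewrite le_eqVlt => /orP[/eqP <- h|t0 h].
  by rewrite oppr0 scale0r addr0 expr0n /= mulr0 (_ : _ - _ = 0) ?normr0 //; ring.
have in_t s : - t <= s <= t -> `|s| <= t by rewrite ler_norml.
have [a /andP[a0 at_] ga] : exists2 a, 0 <= a <= t &
    g (M + t *: W) - g (M + 0 *: W) = 'D_W g (M + a *: W) * (t - 0).
  apply: mvt_line => // s /andP[s0 st]; have [|//] := h s; apply: in_t; lra.
have [c /andP[ct c0] gc] : exists2 c, - t <= c <= 0 &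
    g (M + 0 *: W) - g (M + (- t) *: W) = 'D_W g (M + c *: W) * (0 - - t).
  by apply: mvt_line => [|s /andP[s0 st]]; [lra|have [|//] := h s; apply: in_t; lra].
have B0 : 0 <= B by have [|_ _] := h 0; rewrite ?normr0 ?(ltW t0) //; apply: le_trans.
have slope : `|'D_W g (M + a *: W) - 'D_W g (M + c *: W)| <= B * (2 * t).
  have [ca|] := ltP c a; last first.
    move=> ac; have -> : a = c by lra.
    by rewrite subrr normr0 !mulr_ge0 // ltW.
  have [e /andP[ce ea] ->] : exists2 e, c <= e <= a &
      'D_W g (M + a *: W) - 'D_W g (M + c *: W) =
      'D_W (fun x => 'D_W g x) (M + e *: W) * (a - c).
    apply: (mvt_line (g := fun x => 'D_W g x)) => // s /andP[s0 st].
    by have [|] := h s; first by apply: in_t; lra.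
  rewrite normrM; apply: ler_pM => //.
    by have [|] := h e; first by apply: in_t; lra.
  rewrite ger0_norm; lra.
move: ga gc; rewrite scale0r addr0 subr0 opprK add0r => ga gc.
have -> : g (M + t *: W) + g (M + - t *: W) - 2 * g M =
    ('D_W g (M + a *: W) - 'D_W g (M + c *: W)) * t.
  have -> : g (M + t *: W) + g (M + - t *: W) - 2 * g M =
    (g (M + t *: W) - g M) - (g M - g (M + - t *: W)) by ring.
  by rewrite ga gc; ring.
rewrite normrM (gtr0_norm t0) (_ : 2 * B * t ^+ 2 = B * (2 * t) * t); last by ring.
by rewrite ler_pM2r.
Qed.

Lemma mx_lipschitz n (g : 'M[R]_n.+1 -> R) x h B e :
  (forall s, 0 <= s <= 1 -> differentiable g (x + s *: h) /\
     forall l m, `|'D_(delta_mx l m) g (x + s *: h)| <= B) ->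
  (forall l m, `|h l m| <= e) ->
  `|g (x + h) - g x| <= n.+1%:R * (n.+1%:R * (e * B)).
Proof.
move=> H he.
have [s s01] : exists2 s, 0 <= s <= 1 & g (x + 1 *: h) - g (x + 0 *: h) = 'D_h g (x + s *: h) * (1 - 0).
  by apply: mvt_line => // s /H[dg _]; apply: diff_derivable.
rewrite scale1r scale0r addr0 subr0 mulr1 => ->.
have [] := H s s01; move: (x + s *: h) => z dg bg.
rewrite deriveE // [X in 'd g z X]matrix_sum_delta linear_sum.
apply: le_trans (ler_norm_sum _ _ _) _; apply: sum_le_const => l.
rewrite linear_sum.
apply: le_trans (ler_norm_sum _ _ _) _; apply: sum_le_const => m.
by rewrite linearZ /= normrM -deriveE //; apply: ler_pM.
Qed.

Lemma Ck2_local_bounds n (g : 'M[R]_n.+1 -> R) (U : set 'M[R]_n.+1) (D W : 'M[R]_n.+1) :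
  open U -> U D -> Ck 2 U g ->
  exists d B : R, 0 < d /\ forall x : 'M[R]_n.+1, (forall l m, `|x l m - D l m| <= d) ->
    [/\ U x, differentiable g x, derivable (fun x => 'D_W g x) x W,
      `|'D_W (fun x => 'D_W g x) x| <= B & forall l m, `|'D_(delta_mx l m) g x| <= B].
Proof.
move=> oU UD [dg ddg].
have cont (F : 'M[R]_n.+1 -> R) : {for D, continuous F} ->
    \forall x \near D, `|F x| <= `|F D| + 1.
  by move=> cF; apply: (cvgr_norm_le _ cF); rewrite ltrDl.
have near2 : \forall x \near D, `|'D_W (fun x => 'D_W g x) x| <= `|'D_W (fun x => 'D_W g x) D| + 1.
  by have [_ /(_ W) /(_ D UD) cW] := ddg W; exact: cont cW.
have near1 : \forall x \near D, forall lm : 'I_n.+1 * 'I_n.+1,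
    `|'D_(delta_mx lm.1 lm.2) g x| <= `|'D_(delta_mx lm.1 lm.2) g D| + 1.
  have FF : Filter (nbhs D) by exact: nbhs_filter.
  apply: (@filter_forall _ _ (fun (lm : 'I_n.+1 * 'I_n.+1) (x : 'M[R]_n.+1) =>
    `|'D_(delta_mx lm.1 lm.2) g x| <= `|'D_(delta_mx lm.1 lm.2) g D| + 1) _ FF) => lm.
  have [/(_ D UD) cW _] := ddg (delta_mx lm.1 lm.2).
  exact: cont (differentiable_continuous cW).
have nearU : \forall x \near D, U x by exact: open_nbhs_nbhs.
have [r /= r0 rP] := (nbhs_ballP _ _).1 (filterI nearU (filterI near2 near1)).
pose B := `|'D_W (fun x => 'D_W g x) D| + 1 +
  \sum_(lm : 'I_n.+1 * 'I_n.+1) (`|'D_(delta_mx lm.1 lm.2) g D| + 1).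
exists (r / 2), B; split; first by rewrite divr_gt0.
move=> x xD; have [|Ux [h2 h1]] := rP x.
  split=> // l m; rewrite /ball /= distrC; apply: le_lt_trans (xD l m) _; lra.
split => //; first exact: dg.
- by apply: diff_derivable; have [+ _] := ddg W; apply.
- by apply: le_trans h2 _; rewrite /B lerDl sumr_ge0 // => lm _; rewrite addr_ge0.
- move=> l m; apply: le_trans (h1 (l, m)) _; rewrite /B (bigD1 (l, m)) //=.
  rewrite addrCA lerDl !addr_ge0 // sumr_ge0 // => lm _; rewrite addr_ge0 //.
Qed.

End Smooth.

(** * Quadratic accuracy of the shift near a diagonal matrix *)

Section Quadratic.
Set Implicit Arguments.
Unset Strict Implicit.
Context {R : realType} {n : nat}.
Implicit Types (V Q U M T D : 'M[R]_n.+2) (lam : 'I_n.+2 -> R).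

Lemma corner_dir_off (l m : 'I_n.+2) : (l == ord_max) (+) (m == ord_max) = false ->
  @corner_dir R n l m = 0.
Proof.
have pm := negbTE (inord_neq_ord_max n); have pm' := pm; rewrite eq_sym in pm'.
rewrite !mxE; have [->|lM] := eqVneq l ord_max; have [->|mM] := eqVneq m ord_max => //= _.
- by rewrite pm' addr0.
- by rewrite andbF addr0.
Qed.

Definition last_flip : 'M[R]_n.+2 := diag_mx (\row_j (-1) ^+ (j == ord_max)).

Lemma last_flip_sign : sign_diag last_flip.
Proof.
split; first exact: diag_mx_is_diag.
by move=> i; rewrite !mxE eqxx mulr1n; case: eqP; rewrite ?expr1 ?expr0; [right|left].
Qed.

(** Flipping the last sign reflects [T] across the matrix obtained by erasing its
    corner coupling b. *)
Lemma last_flip_conj T : T^T = T -> tridiagonal T ->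
  last_flip *m T *m last_flip = T - b T *: corner_dir + (- b T) *: corner_dir.
Proof.
move=> sT tri; apply/matrixP => l m; rewrite scaleNr.
rewrite mul_mx_diag mul_diag_mx [RHS]mxE [X in _ = X + _]mxE [X in _ = _ + X + _]mxE [X in _ = _ + X]mxE.
rewrite corner_part // !mxE; case: eqP; case: eqP; rewrite /= ?expr1 ?expr0 => _ _; ring.
Qed.

Lemma TLambda_last_flip lam T : injective lam -> TLambda lam T ->
  TLambda lam (last_flip *m T *m last_flip).
Proof.
move=> lamI TL; have [tri [V VV TE]] := (TLambdaP T lamI).1 TL.
have Et : last_flip^T = last_flip by rewrite tr_diag_mx.
have EE : last_flip *m last_flip = 1%:M.
  apply/matrixP => l m; rewrite mul_diag_mx !mxE; case: (eqVneq l m) => _.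
    by rewrite mulr1n -expr2 sqrr_sign.
  by rewrite mulr0n mulr0.
apply/TLambdaP => //; split.
  by move=> l m lm; rewrite mul_mx_diag mul_diag_mx !mxE tri // mulr0 mul0r.
exists (V *m last_flip); last by rewrite spec_mx_mul -TE Et.
by rewrite trmx_mul Et mulmxA -(mulmxA V) EE mulmx1.
Qed.

(** With M the matrix [T] with its corner coupling erased and T0 as in [exact_deflation],
    the second difference bounds G T + G (ETE) - 2 G M = 2 (sigma T - G M), and the
    Lipschitz bound controls G M - G T0 = G M - lam i. *)
Lemma shift_quadratic_near lam g (sigma : 'M[R]_n.+2 -> R) D :
  eigen_gap lam g -> simple_shift lam sigma -> TLambda lam D -> is_diag_mx D ->
  ~ sing_supp (TLambda lam) sigma D ->
  exists d e C : R, [/\ 0 < d, 0 < e, 0 < C & forall T i, TLambda lam T ->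
    (forall l m, `|T l m - D l m| <= d) -> corner_defect (lam i) T <= e ->
    `|sigma T - lam i| <= C * corner_defect (lam i) T].
Proof.
move=> eg [sigE [Cs Cs0 sigC]] DL /is_diag_mxP dD Dreg.
have [g0 gap] := eg; have lamI := eigen_gap_inj eg.
have [U [G [oU UD CkG GE]]] := sing_supp_smooth (conj DL Dreg).
have [d0 [B [d00 loc]]] := Ck2_local_bounds corner_dir oU UD (CkG 2%N).
have [c c0 exact0] := exact_deflation eg.
have N0 : 0 < 16 * n.+2%:R :> R by rewrite mulr_gt0.
pose e := Num.min (d0 / 2 / c) (g ^+ 2 / (16 * n.+2%:R)).
have e0 : 0 < e by rewrite lt_min !divr_gt0 // exprn_gt0.
have Bge0 : 0 <= B.
  have [|_ _ _ h _] := loc D; first by move=> l m; rewrite subrr normr0 ltW.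
  exact: le_trans h.
exists (d0 / 2), e, (B + n.+2%:R * (n.+2%:R * (c * B)) + 1); split=> //.
- by rewrite divr_gt0.
- by rewrite ltr_wpDl // addr_ge0 // !mulr_ge0 // ltW.
move=> T i TL TD; set E := corner_defect _ T; rewrite le_min => /andP[Ec Eg].
have E0 : 0 <= E by apply: corner_defect_ge0.
have [T0 [T0L T00 T0M]] : exists T0, [/\ TLambda lam T0, corner_defect (lam i) T0 = 0 &
    forall l m, `|T0 l m - (T - b T *: corner_dir) l m| <= c * E].
  by apply: exact0 => //; rewrite mulrC -ler_pdivlMr.
pose M := T - b T *: corner_dir.
have [sT triT _] := TL.
have Moff l m : (l == ord_max) (+) (m == ord_max) -> M l m = 0.
  by move=> lm; rewrite mxE [X in _ + X]mxE corner_part // lm subrr.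
have Mon l m : (l == ord_max) (+) (m == ord_max) = false -> M l m = T l m.
  by move=> lm; rewrite mxE [X in _ + X]mxE corner_part // lm subr0.
have segW s l m : `|s| <= `|b T| -> `|(M + s *: corner_dir) l m - D l m| <= d0 / 2.
  move=> sb; rewrite mxE; case: (boolP ((l == ord_max) (+) (m == ord_max))) => lm.
    have lm' : l != m by apply: contraTneq lm => ->; rewrite addbb.
    rewrite Moff // dD // add0r subr0; apply: le_trans (TD l m).
    rewrite dD // subr0 -[T l m](_ : (b T *: corner_dir) l m = _); last by rewrite corner_part // lm.
    by rewrite [X in `|X| <= _]mxE [X in _ <= `|X|]mxE !normrM ler_wpM2r.
  by rewrite [X in _ + X - _]mxE corner_dir_off ?mulr0 ?addr0 ?Mon ?TD //; apply: negbTE.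
have segM l m : `|M l m - D l m| <= d0 / 2.
  by have := segW 0 l m; rewrite scale0r addr0 normr0; apply.
have cE l m : `|(T0 - M) l m| <= c * E by rewrite !mxE; have := T0M l m; rewrite !mxE.
have cEd : c * E <= d0 / 2 by rewrite mulrC -ler_pdivlMr.
have seg0 s l m : 0 <= s <= 1 -> `|(M + s *: (T0 - M)) l m - D l m| <= d0.
  move=> /andP[s0 s1]; rewrite mxE addrAC; apply: le_trans (ler_normD _ _) _.
  have : `|(s *: (T0 - M)) l m| <= c * E.
    rewrite mxE normrM; apply: le_trans (cE l m).
    by rewrite ler_piMl // ger0_norm.
  have := segM l m; lra.
have d02 : d0 / 2 <= d0 by lra.
have GT : G T = sigma T.
  apply: GE; split=> //; have [|//] := loc T.
  by move=> l m; apply: le_trans (TD l m) _.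
have GT' : G (M + (- b T) *: corner_dir) = sigma T.
  rewrite -last_flip_conj // -(sigE T last_flip) //; last exact: last_flip_sign.
  apply: GE; split; last exact: TLambda_last_flip.
  have [|//] := loc (last_flip *m T *m last_flip); rewrite last_flip_conj // => l m.
  by apply: le_trans (segW _ l m _) _; rewrite ?normrN.
have GT0 : G T0 = lam i.
  have bT0 : b T0 = 0.
    apply/eqP; rewrite -sqrf_eq0 eq_le sqr_ge0 andbT -T00 lerDl; exact: sqr_ge0.
  have -> : G T0 = sigma T0.
    apply: GE; split=> //; have [|//] := loc T0 => l m.
    by have := seg0 1 l m; rewrite scale1r (addrC M) subrK; apply; rewrite ler01 lexx.
  have TT0 : T0 ord_max ord_max = lam i.
    apply/eqP; rewrite -subr_eq0 -sqrf_eq0 eq_le sqr_ge0 andbT -T00 lerDr; exact: sqr_ge0.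
  have [k [s1 s2]] := sigC T0 T0L; move: s1 s2.
  rewrite bT0 normr0 !mulr0 !normr_le0 !subr_eq0 => /eqP -> /eqP <-.
  exact: TT0.
have diff2 : `|G (M + `|b T| *: corner_dir) + G (M + (- `|b T|) *: corner_dir) - 2 * G M|
    <= 2 * B * `|b T| ^+ 2.
  apply: second_difference => // s sb; have [|Ux dG dWG hB _] := loc (M + s *: corner_dir).
    by move=> l m; apply: le_trans (segW s l m sb) _.
  by split => //; apply: diff_derivable.
have GM : `|G (M + (T0 - M)) - G M| <= n.+2%:R * (n.+2%:R * (c * E * B)).
  apply: mx_lipschitz cE => s s01; have [|_ dG _ _ hB] := loc (M + s *: (T0 - M)).
    by move=> l m; apply: seg0.
  by split.
have sum_eq : G (M + `|b T| *: corner_dir) + G (M + (- `|b T|) *: corner_dir) = 2 * sigma T.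
  have h : M + b T *: corner_dir = T by rewrite /M subrK.
  have [bT|bT] := ger0P (b T).
    by rewrite h GT GT'; ring.
  by rewrite opprK h GT GT'; ring.
move: diff2 GM; rewrite sum_eq (addrC M) subrK GT0 real_normK ?num_real // => diff2 GM.
have bE : b T ^+ 2 <= E by rewrite /E lerDl sqr_ge0.
have hB : B * b T ^+ 2 <= B * E by rewrite ler_wpM2l.
rewrite (_ : sigma T - lam i = (2 * sigma T - 2 * G M) / 2 - (lam i - G M)); last by field.
apply: le_trans (ler_normB _ _) _; rewrite normrM (@ger0_norm _ 2^-1) ?invr_ge0 //.
rewrite (_ : (B + n.+2%:R * (n.+2%:R * (c * B)) + 1) * E =
  B * E + n.+2%:R * (n.+2%:R * (c * E * B)) + E); last by ring.
lra.
Qed.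

End Quadratic.

(** * Orbits in the deflation neighborhood *)

Section Final.
Set Implicit Arguments.
Unset Strict Implicit.
Context {R : realType}.

Lemma finite_pos_lower (I : finType) (P : pred I) (F : I -> R) :
  (forall i, P i -> 0 < F i) -> exists2 c, 0 < c & forall i, P i -> c <= F i.
Proof.
move=> F0; exists (\big[Num.min/1]_(i | P i) F i).
  by elim/big_ind: _ => // x y x0 y0; rewrite lt_min x0.
by move=> i Pi; apply: bigmin_le_cond.
Qed.

Lemma eigen_gap_exists n (lam : 'I_n -> R) : injective lam -> exists g, eigen_gap lam g.
Proof.
move=> lamI.
have [|g g0 gP] := @finite_pos_lower _ (fun jk : 'I_n * 'I_n => jk.1 != jk.2)
  (fun jk => `|lam jk.1 - lam jk.2|).
  by move=> [j k] /= jk; rewrite normr_gt0 subr_eq0; apply: contra jk => /eqP/lamI ->.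
by exists g; split=> // j k jk; apply: (gP (j, k)).
Qed.

(** (lam j - s)^2 - (lam k - s)^2 = (lam j - lam k)(lam j + lam k - 2 s), and at s = lam i
    the second factor vanishes only if lam i is the midpoint of lam j and lam k. *)
Lemma ap_free_separation n (lam : 'I_n -> R) :
  injective lam -> ap_free (diag_mx (\row_i lam i)) ->
  exists2 G, 0 < G & exists2 rho, 0 < rho & forall i s, `|s - lam i| <= rho ->
    forall j k, j != k -> G <= `|(lam j - s) ^+ 2 - (lam k - s) ^+ 2|.
Proof.
move=> lamI; have -> : diag_mx (\row_i lam i) = spec_mx 1%:M lam.
  by rewrite /spec_mx trmx1 mul1mx mulmx1.
move=> ap; have spec j : spectrum (spec_mx 1%:M lam) (lam j).
  by rewrite spectrum_spec_mx ?trmx1 ?mulmx1 //; exists j.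
have mid i j k : lam j < lam k -> lam j + lam k != 2 * lam i.
  move=> jk; apply/eqP => h; have := ap _ _ _ (spec j) (spec i) (spec k).
  move=> /(_ _ _)/eqP; apply; lra.
have [|G G0 GP] := @finite_pos_lower _ (fun ijk : 'I_n * ('I_n * 'I_n) => ijk.2.1 != ijk.2.2)
   (fun ijk => `|(lam ijk.2.1 - lam ijk.1) ^+ 2 - (lam ijk.2.2 - lam ijk.1) ^+ 2|).
  move=> [i [j k]] /= jk; rewrite normr_gt0.
  rewrite (_ : _ - _ = (lam j - lam k) * (lam j + lam k - 2 * lam i)); last by ring.
  rewrite mulf_neq0 // subr_eq0; first by apply: contra jk => /eqP/lamI ->.
  have [jk'|kj|/lamI jk'] := ltgtP (lam j) (lam k); first exact: mid.
    by rewrite addrC mid.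
  by rewrite jk' eqxx in jk.
pose L := \sum_j `|lam j|; have L0 : 0 <= L by apply: sumr_ge0.
have lamL j : `|lam j| <= L by rewrite /L (bigD1 j) //= lerDl sumr_ge0.
exists (G / 2); first by rewrite divr_gt0.
exists (G / (8 * L + 1)); first by rewrite divr_gt0 // ltr_wpDl // mulr_ge0.
move=> i s si j k jk; have := GP (i, (j, k)) jk => /=.
have -> : (lam j - lam i) ^+ 2 - (lam k - lam i) ^+ 2 =
  ((lam j - s) ^+ 2 - (lam k - s) ^+ 2) + 2 * (lam j - lam k) * (s - lam i) by ring.
move=> h; have := le_trans h (ler_normD _ _).
have : `|2 * (lam j - lam k) * (s - lam i)| <= G / 2.
  rewrite normrM; apply: (@le_trans _ _ (4 * L * (G / (8 * L + 1)))).
    apply: ler_pM => //; rewrite normrM ger0_norm //.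
    have := ler_normB (lam j) (lam k); have := lamL j; have := lamL k; lra.
  rewrite mulrA ler_pdivrMr ?ltr_wpDl ?mulr_ge0 //.
  rewrite (_ : G / 2 * (8 * L + 1) = 4 * L * G + G / 2); last by field.
  by rewrite lerDl divr_ge0 // ltW.
lra.
Qed.

Section Orbit.
Context {n : nat} (lam : 'I_n.+2 -> R) (sigma : 'M[R]_n.+2 -> R) (g Cs eps : R).
Hypothesis gapg : eigen_gap lam g.
Hypothesis sigmaP : forall T, TLambda lam T ->
     exists i, `|sigma T - lam i| <= Cs * `|b T| /\
               `|T ord_max ord_max - lam i| <= Num.sqrt 2 * `|b T|.
Hypothesis Cs0 : 0 < Cs.
Hypothesis eps0 : 0 < eps.
Hypothesis eps1 : eps <= 1.
Hypothesis eps_shift : Cs * eps <= g / 2.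
Hypothesis eps_defl : 6 * eps <= g ^+ 2.
Hypothesis eps_half : 96 * Cs ^+ 2 * eps <= g ^+ 2.
Hypothesis eps_gap : 4 * eps <= g.

(** The index [i] names the eigenvalue to which both the corner entry and the shift are
    close; [locked_step] shows that it does not change along an orbit. *)
Definition locked i T := [/\ TLambda lam T, `|b T| <= eps,
  `|sigma T - lam i| <= Cs * `|b T| &
  `|T ord_max ord_max - lam i| <= Num.sqrt 2 * `|b T|].

Lemma deflation_locked T : Deflation lam eps T -> exists i, locked i T.
Proof. by move=> [TL bT]; have [i [h1 h2]] := sigmaP TL; exists i. Qed.

Lemma locked_corner_defect i T : locked i T -> corner_defect (lam i) T <= 3 * b T ^+ 2.
Proof.
move=> [_ _ _ h]; rewrite /corner_defect.
suff : (T ord_max ord_max - lam i) ^+ 2 <= 2 * b T ^+ 2 by lra.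
rewrite -[leLHS]real_normK ?num_real // -[X in 2 * X]real_normK ?num_real //.
by rewrite -[2 in leRHS](@sqr_sqrtr R) // -exprMn lerXn2r ?nnegrE ?mulr_ge0 ?sqrtr_ge0.
Qed.

Lemma sqrt2_le2 : Num.sqrt 2 <= 2 :> R.
Proof.
rewrite -(@ler_pXn2r _ 2) ?nnegrE ?sqrtr_ge0 // sqr_sqrtr //.
by rewrite expr2; lra.
Qed.

(** One application of [shift_step] to a defect at most 3 b^2.  The defect of T' is so
    small that its corner entry stays within |b|/2 of lam i, so the index provided for T' by
    the shift strategy has an eigenvalue closer to lam i than the gap. *)
Lemma locked_step i T : locked i T ->
  [/\ Fshift_defined sigma T, locked i (Fshift sigma T),
      `|b (Fshift sigma T)| <= `|b T| / 2,
      b (Fshift sigma T) ^+ 2 <= 24 / g ^+ 2 * (sigma T - lam i) ^+ 2 * b T ^+ 2 &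
      exists U, qr_star (T - (sigma T)%:M) (Qstar (T - (sigma T)%:M)) U].
Proof.
move=> lk; have [TL bT sT TT] := lk; have [g0 gap] := gapg.
have g20 : 0 < g ^+ 2 by rewrite exprn_gt0.
have dT := locked_corner_defect lk.
have bb : b T ^+ 2 <= eps.
  rewrite -real_normK ?num_real // expr2; apply: le_trans (ler_pM _ _ bT bT) _ => //.
  by rewrite ler_piMr // ltW.
have sg : `|sigma T - lam i| <= g / 2.
  by apply: le_trans sT _; apply: le_trans eps_shift; rewrite ler_pM2l.
have small : 2 * corner_defect (lam i) T <= g ^+ 2 by have := eps_defl; lra.
have [kM step] := shift_step gapg TL sg small.
have [U qr] := Qstar_qr_star kM.
have [T'L defl'] := step _ _ qr; rewrite -/(Fstep _ _) -/(Fshift sigma T) in T'L defl'.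
set T' := Fshift sigma T in T'L defl' *.
have defl'' : corner_defect (lam i) T' <= 24 / g ^+ 2 * (sigma T - lam i) ^+ 2 * b T ^+ 2.
  apply: le_trans defl' _.
  rewrite (_ : 24 / _ * _ * _ = 8 / g ^+ 2 * (sigma T - lam i) ^+ 2 * (3 * b T ^+ 2)); last by ring.
  by rewrite ler_wpM2l // mulr_ge0 ?sqr_ge0 // divr_ge0 // ltW.
have s2 : (sigma T - lam i) ^+ 2 <= Cs ^+ 2 * eps.
  apply: (@le_trans _ _ (Cs ^+ 2 * b T ^+ 2)); last by rewrite ler_pM2l // exprn_gt0.
  rewrite -[leLHS]real_normK ?num_real // -[b T ^+ 2]real_normK ?num_real // -exprMn.
  by rewrite lerXn2r ?nnegrE // mulr_ge0 // ltW.
have quarter : corner_defect (lam i) T' <= (`|b T| / 2) ^+ 2.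
  apply: le_trans defl'' _; rewrite expr_div_n real_normK ?num_real // [leRHS]mulrC.
  rewrite ler_wpM2r ?sqr_ge0 //.
  rewrite mulrAC ler_pdivrMr //.
  have : 24 * (sigma T - lam i) ^+ 2 <= 24 * (Cs ^+ 2 * eps) by rewrite ler_pM2l.
  rewrite (_ : 2 ^+ 2 = 4 :> R); [have := eps_half; lra|by rewrite expr2; ring].
have half x : x ^+ 2 <= corner_defect (lam i) T' -> `|x| <= `|b T| / 2.
  move=> h; rewrite -(@ler_pXn2r _ 2) ?nnegrE // ?divr_ge0 // real_normK ?num_real //.
  exact: le_trans quarter.
have b' : `|b T'| <= `|b T| / 2 by apply: half; rewrite /corner_defect lerDl sqr_ge0.
have T'T' : `|T' ord_max ord_max - lam i| <= `|b T| / 2.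
  by apply: half; rewrite /corner_defect lerDr sqr_ge0.
split => //; first exact/almost_invertibleP.
- have [k [h1 h2]] := sigmaP T'L.
  have -> : i = k; last by split=> //; apply: le_trans b' _; have := normr_ge0 (b T); lra.
  apply/eqP/negPn/negP => /gap ik.
  have : Num.sqrt 2 * `|b T'| <= 2 * (`|b T| / 2).
    by apply: ler_pM; rewrite ?sqrtr_ge0 ?sqrt2_le2.
  have := ler_distD (T' ord_max ord_max) (lam i) (lam k); rewrite (distrC (lam i) (T' _ _)).
  have := normr_ge0 (b T); have := eps_gap; have := eps0; lra.
- by apply: le_trans defl''; rewrite /corner_defect lerDl sqr_ge0.
- by exists U.
Qed.

Lemma invariant_deflation : invariant_under sigma (Deflation lam eps).
Proof.
move=> T /deflation_locked [i /locked_step [dF [TL bF _ _] _ _ _]].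
by split.
Qed.

Section Iterates.
Variables (i : 'I_n.+2) (T : 'M[R]_n.+2).
Hypothesis lk : locked i T.

Let orb k := iter k (Fshift sigma) T.

Lemma orbit_locked k : locked i (orb k).
Proof. by elim: k => //= k /locked_step[]. Qed.

Lemma orbit_b k : `|b (orb k)| <= eps * (1 / 2) ^+ k.
Proof.
elim: k => [|k IH]; first by rewrite expr0 mulr1; have [] := lk.
have [_ _ h _ _] := locked_step (orbit_locked k).
apply: le_trans h _; rewrite exprSr; move: IH; rewrite -/(orb k); lra.
Qed.

Lemma orbit_qr : exists U : nat -> 'M[R]_n.+2, forall k,
  let N := orb k - (sigma (orb k))%:M in qr_star N (Qstar N) (U k).
Proof.
have h k : exists U, let N := orb k - (sigma (orb k))%:M in qr_star N (Qstar N) U.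
  by have [] := locked_step (orbit_locked k).
by have [U UP] := choice h; exists U.
Qed.

(** Telescoping [lyapunov_decrease]; the shift errors form a geometric series
    since b is halved at each step.  The bound depends on the orbit only through [i]. *)
Lemma orbit_upper_mass (U : nat -> 'M[R]_n.+2) :
  (forall k, let N := orb k - (sigma (orb k))%:M in qr_star N (Qstar N) (U k)) ->
  forall m, \sum_(k < m) upper_mass (U k) <=
   (\sum_(l < n.+2) l%:R * \sum_j (lam j - lam i) ^+ 2) + 2 * (Cs * lyapunov_lip lam).
Proof.
move=> qr m; have lamI := eigen_gap_inj gapg.
have LL0 : 0 <= lyapunov_lip lam.
  by rewrite /lyapunov_lip mulr_ge0 // sumr_ge0 // => l _; rewrite !mulr_ge0 // sumr_ge0.
have frame k : exists2 V, V *m V^T = 1%:M & orb k = spec_mx V lam.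
  by have [/(TLambdaP _ lamI)[_ //]] := orbit_locked k.
have term k : upper_mass (U k) <= lyapunov (lam i) (orb k) - lyapunov (lam i) (orb k.+1)
    + Cs * lyapunov_lip lam * (1 / 2) ^+ k.
  have [V VV TE] := frame k; have := qr k; rewrite /= => q.
  have := @lyapunov_decrease _ _ V lam (lam i) (sigma (orb k)) _ _ VV.
  rewrite -TE => /(_ _ _ q) h; apply: le_trans h _.
  rewrite lerD2l; have [_ _ h _] := orbit_locked k.
  rewrite mulrAC; apply: ler_wpM2r => //; apply: le_trans h _.
  rewrite ler_pM2l //; apply: le_trans (orbit_b k) _.
  by rewrite ler_piMl // exprn_ge0.
have part : \sum_(k < m) upper_mass (U k) <= lyapunov (lam i) (orb 0) - lyapunov (lam i) (orb m)
    + Cs * lyapunov_lip lam * (2 * (1 - (1 / 2) ^+ m)).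
  elim: m => [|m IH]; first by rewrite big_ord0 expr0 !subrr mulr0 mulr0 addr0.
  rewrite big_ord_recr /=; have := term m; rewrite exprSr.
  set x := (1 / 2) ^+ m in IH *; set c := Cs * _ in IH *; move: IH.
  have -> : c * (2 * (1 - x * (1 / 2))) = c * (2 * (1 - x)) + c * x by field.
  by rewrite -/(orb m.+1); lra.
apply: le_trans part _; apply: lerD.
  have [V VV TE] := frame 0; have [V' VV' TE'] := frame m.
  have := lyapunov_ge0 lam (lam i) VV'; have := lyapunov_le lam (lam i) VV.
  rewrite -TE -TE'; lra.
rewrite [leRHS]mulrC; apply: ler_wpM2l; first by rewrite mulr_ge0 // ltW.
have : 0 <= (1 / 2 : R) ^+ m by rewrite exprn_ge0.
lra.
Qed.

End Iterates.
End Orbit.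

End Final.

(** * Bounded series and convergence of orbits *)

Section Series.
Set Implicit Arguments.
Unset Strict Implicit.
Context {R : realType}.
Variables (S : nat -> R) (M : R).
Hypothesis S0 : forall k, 0 <= S k.
Hypothesis SM : forall m, \sum_(k < m) S k <= M.

(** Counting the large terms met before k is an injection from the large indices
    into an initial segment. *)
Lemma few_large (eta : R) K : 0 < eta -> M <= eta * K%:R ->
  [set k | eta < S k] #<= `I_K.
Proof.
move=> eta0 MK; pose f k := (\sum_(j < k) (eta < S j)%R)%N.
have fS k : f k.+1 = (f k + (eta < S k)%R)%N by rewrite /f big_ord_recr.
have fle k m : (k <= m)%N -> (f k <= f m)%N.
  elim: m => [|m IH]; rewrite leq_eqVlt => /orP[/eqP -> //|//].
  by rewrite ltnS fS => /IH h; apply: leq_trans h (leq_addr _ _).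
have fK m : (f m <= K)%N.
  rewrite -(ler_nat R) -(ler_pM2l eta0); apply: le_trans MK; apply: le_trans (SM m).
  rewrite /f natr_sum mulr_sumr; apply: ler_sum => j _; case: ltP => h.
    by rewrite mulr1 ltW.
  by rewrite mulr0.
have finj : {in [set k | eta < S k] &, injective f}.
  have lt k m : eta < S k -> (k < m)%N -> (f k < f m)%N.
    by move=> h /fle; rewrite fS h addn1.
  move=> k m /[!inE] /= hk hm fkm; case: (ltngtP k m) => // [/(lt _ _ hk)|/(lt _ _ hm)];
    by rewrite fkm ltnn.
apply: (@card_le_trans _ _ _ (f @` [set k | eta < S k])).
  by have /card_eqPle[] := inj_card_eq finj.
apply: subset_card_le => _ [k /= hk <-]; have := fK k.+1.
by rewrite fS hk addn1.
Qed.

Lemma summable_small (eta : R) : 0 < eta -> exists k0, forall k, (k0 <= k)%N -> S k <= eta.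
Proof.
move=> eta0.
have cS : cvgn (series S).
  apply: nondecreasing_is_cvgn.
    by apply/nondecreasing_seqP => k; rewrite !seriesEnat /= big_nat_recr //= lerDl.
  exists M => _ [m _ <-]; rewrite seriesEnat /= big_mkord; exact: SM.
have [k0 _ h] := cvgr0_norm_le S (cvg_series_cvg_0 cS) _ eta0.
by exists k0 => k /h /=; rewrite ger0_norm.
Qed.

End Series.

Section Convergence.
Set Implicit Arguments.
Unset Strict Implicit.
Context {R : realType} {n : nat} (lam : 'I_n.+2 -> R) (sigma : 'M[R]_n.+2 -> R) (g Cs eps : R).
Hypothesis gapg : eigen_gap lam g.
Variables (i : 'I_n.+2) (T : 'M[R]_n.+2) (U : nat -> 'M[R]_n.+2) (G B M : R).
Let orb k := iter k (Fshift sigma) T.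
Hypothesis frame : forall k, exists2 V, V *m V^T = 1%:M & orb k = spec_mx V lam.
Hypothesis qr : forall k, let N := orb k - (sigma (orb k))%:M in qr_star N (Qstar N) (U k).
Hypothesis mass : forall m, \sum_(k < m) upper_mass (U k) <= M.
Hypothesis G0 : 0 < G.
Hypothesis B0 : 0 < B.
Hypothesis sep : forall k j l, j != l ->
  G <= `|(lam j - sigma (orb k)) ^+ 2 - (lam l - sigma (orb k)) ^+ 2|.
Hypothesis bound : forall k j, `|lam j - sigma (orb k)| <= B.

Let small (eta : R) : 0 < eta -> exists k0, forall k, (k0 <= k)%N -> upper_mass (U k) <= eta.
Proof. exact: summable_small (fun k => upper_mass_ge0 (U k)) mass _. Qed.

Lemma orbit_near_diag d : 0 < d -> exists k0, forall k, (k0 <= k)%N ->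
  exists2 p, injective p & near_diag lam p d (orb k).
Proof.
move=> d0; have [eta eta0 etaP] := small_upper_mass_near_diag lam G0 B0 d0.
have [k0 k0P] := small eta0; exists k0 => k /k0P Uk.
have [V VV TE] := frame k; rewrite TE; apply: (etaP V (sigma (orb k)) _ (U k)) => //.
- exact: sep.
- by have := qr k; rewrite /= TE; apply.
Qed.

(** Diagonals of (T_k - s)^2 and (T_{k+1} - s)^2 differ by at most the mass of U_k, so
    by separation the diagonal matrices near T_k and T_{k+1} are eventually the same. *)
Lemma orbit_pattern : exists d p k0, [/\ 0 < d, 2 * d < g &
  forall k, (k0 <= k)%N -> near_diag lam p d (orb k)].
Proof.
have [g0 gap] := gapg.
(* The constant of [near_diag_sqr_shift].  The errors made in comparing the squares for
   steps k and k+1 have to add up to less than G. *)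
pose c := 2 * B + 1 + n.+2%:R.
have c0 : 0 < c by rewrite !addr_gt0 ?mulr_gt0.
pose d := Num.min (g / 4) (Num.min 1 (G / (8 * c))).
have d0 : 0 < d by rewrite !lt_min ltr01 !divr_gt0 ?mulr_gt0.
have dg : d <= g / 4 by rewrite ge_min lexx.
have d1 : d <= 1 by rewrite !ge_min lexx orbT.
have dc : d * c <= G / 8.
  have : d <= G / (8 * c) by rewrite !ge_min lexx !orbT.
  by rewrite ler_pdivlMr ?mulr_gt0 //; lra.
have [k1 near1] := orbit_near_diag d0.
have G8 : 0 < G / 8 by rewrite divr_gt0.
have [k2 small2] := small G8.
pose k0 := maxn k1 k2.
have /choice [p pP] : forall k, exists p : 'I_n.+2 -> 'I_n.+2, (k0 <= k)%N -> near_diag lam p d (orb k).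
  move=> k; have [kk|kk] := leqP k0 k; last by exists id.
  by have [|p _ pP] := near1 k; [rewrite (leq_trans _ kk) // leq_maxl|exists p].
have pS k : (k0 <= k)%N -> p k.+1 =1 p k.
  move=> kk l; apply/eqP/negPn/negP => ne.
  have := sep k ne; set s := sigma (orb k).
  have sT m : (orb m)^T = orb m by have [V _ ->] := frame m; rewrite spec_mx_sym.
  (* Both squares use the shift of step k, which is the one for which U_k factors T_k. *)
  have := near_diag_sqr_shift l (sT k) (ltW d0) d1 (pP k kk) (bound k).
  have := near_diag_sqr_shift l (sT k.+1) (ltW d0) d1 (pP k.+1 (leqW kk)) (bound k).
  have swap : `|sqr_shift s (orb k.+1) l l - sqr_shift s (orb k) l l| <= upper_mass (U k).
    have q := qr k; have sN : (orb k - s%:M)^T = orb k - s%:M.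
      by rewrite linearB /= sT tr_scalar_mx.
    have := gram_swap_diag l (qr_star_trig q).
    rewrite (qr_star_gram q) // (qr_star_cogram q) //.
    have [_ [QQ _] _ _] := q.
    by rewrite -(sqr_shift_conj (orb k) s QQ).
  have := small2 k (leq_trans (leq_maxr _ _) kk).
  rewrite -/s -/c; move: swap; rewrite !ler_norml.
  set x := sqr_shift _ _ _ _; set y := sqr_shift _ _ _ _.
  set u := (lam _ - s) ^+ 2; set v := (lam _ - s) ^+ 2.
  move=> /andP[h1 h2] h3 /andP[h4 h5] /andP[h6 h7].
  by rewrite ler_normr => /orP[h8|h8]; lra.
exists d, (p k0), k0; split=> //; first by lra.
have pE k : p (k0 + k)%N =1 p k0.
  elim: k => [|k IH] l; first by rewrite addn0.
  by rewrite addnS pS ?leq_addr // IH.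
move=> k kk l m; have := pP k kk l m.
by have := pE (k - k0)%N l; rewrite subnKC // => ->.
Qed.

Lemma orbit_converges : exists2 D : 'M[R]_n.+2, is_diag_mx D & orb @ \oo --> D.
Proof.
have [d1 [p [k1 [d10 dg near1]]]] := orbit_pattern.
exists (diag_mx (\row_l lam (p l))); first exact: diag_mx_is_diag.
apply/cvg_ballP => e e0.
(* Any pattern at a distance below g/2 from the orbit is the one found first. *)
pose d := Num.min d1 (e / 2).
have d0 : 0 < d by rewrite lt_min d10 divr_gt0.
have [k2 near2] := orbit_near_diag d0.
exists (maxn k1 k2) => // k /=; rewrite geq_max => /andP[kk1 kk2].
have [q _ qP] := near2 k kk2.
have de : d < e by apply: (@le_lt_trans _ _ (e / 2)); [rewrite ge_min lexx orbT|lra].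
have dd1 : d <= d1 by rewrite ge_min lexx.
have qp l : q l = p l.
  apply/eqP/negPn/negP => /(gapg.2 _ _) h.
  have := qP l l; have := near1 k kk1 l l; rewrite eqxx !mul1r => h1 h2.
  have := ler_distD (orb k l l) (lam (q l)) (lam (p l)); rewrite (distrC (lam (q l)) (orb k l l)).
  lra.
split=> // l m; rewrite /ball /= distrC; apply: le_lt_trans de.
have := qP l m; rewrite qp !mxE; have [<-|_] := eqVneq l m.
  by rewrite mul1r mulr1n.
by rewrite mul0r mulr0n.
Qed.

End Convergence.

(** * Uniformity over the diagonal matrices *)

Section Uniform.
Set Implicit Arguments.
Unset Strict Implicit.
Context {R : realType} {n : nat}.
Implicit Types (lam : 'I_n.+2 -> R) (p : 'I_n.+2 -> 'I_n.+2).

Lemma diag_perm_TLambda lam p : injective p -> TLambda lam (diag_mx (\row_l lam (p l))).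
Proof.
move=> pI; split; first exact: tr_diag_mx.
  move=> l m lm; rewrite !mxE; case: eqP lm => [->|_ _]; last by rewrite mulr0n.
  by rewrite !ltnNge !leqnSn.
have -> : diag_mx (\row_l lam (p l)) = spec_mx 1%:M (fun l => lam (p l)).
  by rewrite /spec_mx trmx1 mul1mx mulmx1.
rewrite spectrum_spec_mx ?trmx1 ?mulmx1 //; apply/seteqP; split=> [_ [l _ <-]|_ [l _ <-]].
  by exists (p l).
by exists (invF pI l) => //; rewrite f_invF.
Qed.

(** TLambda contains finitely many diagonal matrices, one for each bijection [p]. *)
Lemma shift_quadratic_uniform lam g (sigma : 'M[R]_n.+2 -> R) :
  eigen_gap lam g -> simple_shift lam sigma ->
  (forall D, TLambda lam D -> is_diag_mx D -> ~ sing_supp (TLambda lam) sigma D) ->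
  exists d e C : R, [/\ 0 < d, 0 < e, 0 < C & forall p T i, injective p -> TLambda lam T ->
    near_diag lam p d T -> corner_defect (lam i) T <= e ->
    `|sigma T - lam i| <= C * corner_defect (lam i) T].
Proof.
move=> eg ss reg.
have /fin_all_exists [c cP] : forall p : {ffun 'I_n.+2 -> 'I_n.+2}, exists c : R * R * R,
    injective p -> [/\ 0 < c.1.1, 0 < c.1.2, 0 < c.2 & forall T i, TLambda lam T ->
    near_diag lam p c.1.1 T -> corner_defect (lam i) T <= c.1.2 ->
    `|sigma T - lam i| <= c.2 * corner_defect (lam i) T].
  move=> p; have [pI|npI] := pselect (injective p); last by exists (1, 1, 1).
  have DL := diag_perm_TLambda lam pI; have dD := diag_mx_is_diag (\row_l lam (p l)).
  have [d [e [C [d0 e0 C0 H]]]] := shift_quadratic_near eg ss DL dD (reg _ DL dD).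
  exists (d, e, C) => _; split=> // T i TL near; apply: H => // l m.
  by rewrite !mxE -[lam (p l) *+ _]mulr_natl; exact: near.
have [|d d0 dP] := @finite_pos_lower R {ffun 'I_n.+2 -> 'I_n.+2} (fun q => injectiveb q)
  (fun q => (c q).1.1).
  by move=> q /injectiveP/cP[].
have [|e e0 eP] := @finite_pos_lower R {ffun 'I_n.+2 -> 'I_n.+2} (fun q => injectiveb q)
  (fun q => (c q).1.2).
  by move=> q /injectiveP/cP[].
pose C : R := 1 + \sum_q `|(c q).2|.
exists d, e, C; split=> //; first by rewrite ltr_wpDr ?sumr_ge0.
move=> p T i pI TL near Te; pose q := finfun p.
have qE : q =1 p by move=> l; rewrite ffunE.
have qI : injective q by move=> l m; rewrite !qE => /pI.
have qB : injectiveb q by apply/injectiveP.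
have [_ _ C0 H] := cP q qI.
have : `|sigma T - lam i| <= (c q).2 * corner_defect (lam i) T.
  apply: H => //; last exact: le_trans (eP q qB).
  by move=> l m; rewrite qE; apply: le_trans (near l m) (dP q qB).
move=> h; apply: le_trans h _; apply: ler_wpM2r; first exact: corner_defect_ge0.
apply: le_trans (ler_norm _) _; rewrite /C (bigD1 q) //= addrCA lerDl addr_ge0 // sumr_ge0 //.
Qed.

End Uniform.

Theorem theorem3 (R : realType) (n : nat) (lam : 'I_n.+2 -> R)
    (sigma : 'M[R]_n.+2 -> R)
    (lam_incr : forall i j : 'I_n.+2, (i < j)%N -> lam i < lam j)
    (lam_ap_free : ap_free (diag_mx (\row_i lam i)))
    (sigma_shift : simple_shift lam sigma)
    (sigma_smooth : forall T : 'M[R]_n.+2, TLambda lam T -> is_diag_mx T ->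
       ~ sing_supp (TLambda lam) sigma T) :
  exists (eps C : R) (K : nat), [/\ 0 < eps, 0 < C & (0 < K)%N] /\
    invariant_under sigma (Deflation lam eps) /\
    (forall T : 'M[R]_n.+2, Deflation lam eps T ->
       (exists2 D : 'M[R]_n.+2, is_diag_mx D &
          (fun k => iter k (Fshift sigma) T) @ \oo --> D) /\
       [set k | (0 < k)%N /\
          `|b (iter k.+1 (Fshift sigma) T)| >
            C * `|b (iter k (Fshift sigma) T)| ^+ 3] #<= `I_K).
Proof.
have lamI : injective lam.
  move=> i j ij; apply/eqP/negPn/negP; rewrite -val_eqE neq_ltn.
  by move=> /orP[] /lam_incr; rewrite ij ltxx.
have [g gapg] := eigen_gap_exists lamI; have [g0 gap] := gapg.
have g20 : 0 < g ^+ 2 by rewrite exprn_gt0.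
have [G G0 [rho rho0 sep]] := ap_free_separation lamI lam_ap_free.
have [_ [Cs Cs0 sigmaP]] := sigma_shift.
have [d [e [C1 [d0 e0 C10 quad]]]] := shift_quadratic_uniform gapg sigma_shift sigma_smooth.
pose L := \sum_j `|lam j|; have L0 : 0 <= L by apply: sumr_ge0.
have lamL j : `|lam j| <= L by rewrite /L (bigD1 j) //= lerDl sumr_ge0.
pose B := 2 * L + rho; have B0 : 0 < B by rewrite ltr_wpDl // mulr_ge0.
have [eta eta0 etaP] := small_upper_mass_near_diag lam G0 B0 d0.
(* In order: b^2 <= eps; the shift is closest to lam i; the squares (lam j - s)^2
   are separated; the defect, at most 3 b^2, is small enough for [shift_step]; b is
   halved; the index i persists; [shift_quadratic_uniform] applies. *)
pose eps := Num.min 1 (Num.min (g / 2 / Cs) (Num.min (rho / Cs) (Num.min (g ^+ 2 / 6)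
  (Num.min (g ^+ 2 / (96 * Cs ^+ 2)) (Num.min (g / 4) (e / 3)))))).
have eps0 : 0 < eps by rewrite !lt_min ltr01 !divr_gt0 // mulr_gt0 // exprn_gt0.
have [eps1 [eps_shift [eps_rho [eps_defl [eps_half [eps_gap eps_e]]]]]] :
  eps <= 1 /\ Cs * eps <= g / 2 /\ Cs * eps <= rho /\ 6 * eps <= g ^+ 2 /\
  96 * Cs ^+ 2 * eps <= g ^+ 2 /\ 4 * eps <= g /\ 3 * eps <= e.
  have : eps <= eps by [].
  rewrite {2}/eps !le_min => /and5P[h1 h2 h3 h4 /and3P[h5 h6 h7]].
  rewrite !ler_pdivlMr // ?mulr_gt0 ?exprn_gt0 // in h2 h3 h4 h5 h6 h7.
  by do !split; lra.
pose Mass := \sum_i ((\sum_(l < n.+2) l%:R * \sum_j (lam j - lam i) ^+ 2) + 2 * (Cs * lyapunov_lip lam)).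
have term0 i : 0 <= (\sum_(l < n.+2) l%:R * \sum_j (lam j - lam i) ^+ 2) + 2 * (Cs * lyapunov_lip lam).
  apply: addr_ge0.
    apply: sumr_ge0 => l _; apply: mulr_ge0 => //; apply: sumr_ge0 => j _; exact: sqr_ge0.
  rewrite !mulr_ge0 ?(ltW Cs0) // sumr_ge0 // => l _; rewrite !mulr_ge0 //.
have mass_le i : (\sum_(l < n.+2) l%:R * \sum_j (lam j - lam i) ^+ 2) +
    2 * (Cs * lyapunov_lip lam) <= Mass.
  by rewrite /Mass [leRHS](bigD1 i) //= lerDl sumr_ge0.
have [K MK] : exists K, Mass <= eta * K.+1%:R.
  have Mass0 : 0 <= Mass / eta by rewrite divr_ge0 ?(ltW eta0) // sumr_ge0.
  exists (Num.bound (Mass / eta)); rewrite mulrC -ler_pdivrMr //.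
  by apply: le_trans (ltW (archi_boundP Mass0)) _; rewrite ler_nat.
(* b(T')^2 <= 24 (3 C1)^2 b^6 / g^2 at the good steps, and 216 <= 15^2. *)
exists eps, (15 * C1 / g), K.+1; split; first by split; rewrite ?divr_gt0 ?mulr_gt0.
split; first exact: (invariant_deflation gapg sigmaP).
move=> T /(deflation_locked sigmaP) [i lk].
have lkk := orbit_locked gapg sigmaP Cs0 eps0 eps1 eps_shift eps_defl eps_half eps_gap lk.
have [U qr] := orbit_qr gapg sigmaP Cs0 eps0 eps1 eps_shift eps_defl eps_half eps_gap lk.
have mass := orbit_upper_mass gapg sigmaP Cs0 eps0 eps1 eps_shift eps_defl eps_half eps_gap lk qr.
have frame k : exists2 V, V *m V^T = 1%:M & iter k (Fshift sigma) T = spec_mx V lam.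
  by have [/(TLambdaP _ lamI)[_ //]] := lkk k.
have sig k : `|sigma (iter k (Fshift sigma) T) - lam i| <= rho.
  have [_ bk h _] := lkk k; apply: le_trans h _; apply: le_trans eps_rho.
  by rewrite ler_pM2l.
have sepk k := sep i _ (sig k).
have bound k j : `|lam j - sigma (iter k (Fshift sigma) T)| <= B.
  have := ler_distD (lam i) (lam j) (sigma (iter k (Fshift sigma) T)).
  have := ler_normB (lam j) (lam i); have := lamL i; have := lamL j.
  have := sig k; rewrite (distrC (sigma _)) /B; lra.
split; first exact: (orbit_converges gapg frame qr mass G0 B0 sepk bound).
apply: card_le_trans (few_large (fun k => upper_mass_ge0 (U k))
  (fun m => le_trans (mass m) (mass_le i)) eta0 MK).
apply: subset_card_le => k [_ /= bk].
rewrite ltNge; apply/negP => Uk; move: bk; apply/negP; rewrite -leNgt.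
have [V VV TE] := frame k; have [TL bk _ _] := lkk k.
have [p pI near] : exists2 p, injective p & near_diag lam p d (iter k (Fshift sigma) T).
  rewrite TE; apply: (etaP V (sigma (spec_mx V lam)) _ (U k)) => //.
  - by rewrite -TE; apply: sepk.
  - by rewrite -TE; apply: bound.
  - by have := qr k; rewrite /= TE; apply.
have [_ _ _ step _] := locked_step gapg sigmaP Cs0 eps0 eps1 eps_shift eps_defl eps_half eps_gap (lkk k).
have dk := locked_corner_defect (lkk k).
move: step near TL bk dk; rewrite -[Fshift _ (iter _ _ _)]/(iter k.+1 _ _).
set T' := iter k.+1 _ _; set Tk := iter k _ _ => step near TL bk dk.
have b2 : b Tk ^+ 2 <= eps.
  rewrite -real_normK ?num_real // expr2; apply: le_trans (ler_pM _ _ bk bk) _ => //.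
  by rewrite ler_piMr // ltW.
have q3 : `|sigma Tk - lam i| <= C1 * (3 * b Tk ^+ 2).
  apply: le_trans (quad p Tk i pI TL near _) _; first by lra.
  by rewrite ler_pM2l.
have q6 : (sigma Tk - lam i) ^+ 2 <= (C1 * (3 * b Tk ^+ 2)) ^+ 2.
  rewrite -[leLHS]real_normK ?num_real // lerXn2r ?nnegrE //.
  exact: le_trans q3.
rewrite -(@ler_pXn2r _ 2) ?nnegrE // ?mulr_ge0 ?invr_ge0 ?(ltW g0) ?(ltW C10) ?exprn_ge0 //.
rewrite real_normK ?num_real //; apply: le_trans step _.
apply: (@le_trans _ _ (24 / g ^+ 2 * (C1 * (3 * b Tk ^+ 2)) ^+ 2 * b Tk ^+ 2)).
  by rewrite ler_wpM2r ?sqr_ge0 // ler_wpM2l // divr_ge0 // ltW.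
have -> : (15 * C1 / g * `|b Tk| ^+ 3) ^+ 2 = 225 * C1 ^+ 2 / g ^+ 2 * (`|b Tk| ^+ 2) ^+ 3.
  by field; rewrite gt_eqF.
rewrite real_normK ?num_real //.
have -> : 24 / g ^+ 2 * (C1 * (3 * b Tk ^+ 2)) ^+ 2 * b Tk ^+ 2 =
    216 * C1 ^+ 2 / g ^+ 2 * (b Tk ^+ 2) ^+ 3.
  by field; rewrite gt_eqF.
apply: ler_wpM2r; first by rewrite exprn_ge0 ?sqr_ge0.
apply: ler_wpM2r; first by rewrite invr_ge0 ltW.
by apply: ler_wpM2r; rewrite ?sqr_ge0 ?ler_nat.
Qed.
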